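(* Let $L$ be a Sierpinski lattice with no boundary point. Let $R(\lambda)=\lambda(5-\lambda)$, let $\mathcal{J}$ be the Julia set of $R$, and write $\Sigma_5=\bigcup_{m=0}^\infty R^{\circ-m}\{5\}$ and $\Sigma_6=\{6\}\cup\bigcup_{m=0}^\infty R^{\circ-m}\{3\}$. For every $1<p<\infty$, the operator $\Delta:\ell^p(L)\to\ell^p(L)$ has point spectrum $\sigma_p(\Delta)=\Sigma_5\cup\Sigma_6$, continuous spectrum $\sigma_c(\Delta)=\mathcal{J}\setminus\Sigma_5$, and empty residue spectrum $\sigma_r(\Delta)=\emptyset$.
   Context: Sierpinski lattice: let $F_0(x)=\frac12x+(\frac14,\frac{\sqrt3}{4})$, $F_1(x)=\frac12x$, $F_2(x)=\frac12x+(\frac12,0)$ on $\mathbb{R}^2$, with fixed points $q_0=(\frac12,\frac{\sqrt3}{2})$, $q_1=(0,0)$, $q_2=(1,0)$. Put $V_0=\{q_0,q_1,q_2\}$ and $V_m=\bigcup_{i=0}^2F_i(V_{m-1})$ for $m\ge1$. For an infinite word $\omega=\omega_1\omega_2\cdots\in\{0,1,2\}^\infty$, the Sierpinski lattice is the infinite graph with vertex set $L=L_\omega=\bigcup_{m=1}^\infty F_{\omega_1}^{-1}\cdots F_{\omega_m}^{-1}(V_m)$, where distinct $x,y\in L$ are neighbours, written $x\sim y$, if $x,y\in F_{\omega_1}^{-1}\cdots F_{\omega_m}^{-1}F_{l_m}F_{l_{m-1}}\cdots F_{l_1}(V_0)$ for some $m\geq 1$ and $l_1,\dots,l_m\in\{0,1,2\}$.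 Every vertex has four neighbours except a boundary vertex (boundary point), which has exactly two. A boundary point exists if and only if there are $M\in\mathbb{N}$ and $i\in\{0,1,2\}$ with $\omega_m=i$ for all $m\ge M$; here it is assumed that there is none. Laplacian: $\Delta f(x)=\sum_{y\sim x}f(y)-4f(x)$ for all $x\in L$ (no boundary). Spectra of $\Delta:\ell^p(L)\to\ell^p(L)$ (with this sign convention): $\sigma_p(\Delta)=\{\lambda\in\mathbb{C}:\lambda+\Delta\text{ is not injective}\}$; $\sigma_c(\Delta)$ is the set of $\lambda\in\mathbb{C}\setminus\sigma_p(\Delta)$ such that $\lambda+\Delta$ is not surjective and $(\lambda+\Delta)(\ell^p(L))$ is dense in $\ell^p(L)$; $\sigma_r(\Delta)$ is the set of $\lambda\in\mathbb{C}\setminus\sigma_p(\Delta)$ such that $\lambda+\Delta$ is not surjective and $(\lambda+\Delta)(\ell^p(L))$ is not dense in $\ell^p(L)$. The Julia set $\mathcal{J}$ of $R$ is here equivalently $\{x\in\mathbb{C}:\sup_{k\ge0}|R^{\circ k}(x)|<\infty\}$. $R^{\circ k}$ is the $k$-fold iterate and $R^{\circ-m}\{a\}=\{\lambda\in\mathbb{C}:R^{\circ m}(\lambda)=a\}$. *)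

(* Defs.v *)
From mathcomp Require Import all_boot all_order all_algebra.
From mathcomp Require Import all_classical all_reals all_analysis.
From mathcomp Require Import complex.

Set Implicit Arguments.
Unset Strict Implicit.
Unset Printing Implicit Defensive.

Import Order.TTheory GRing.Theory Num.Theory.
Import numFieldNormedType.Exports.

Local Open Scope classical_set_scope.
Local Open Scope ring_scope.
Local Open Scope complex_scope.

Section SierpinskiLattice.
Variable R : realType.

Definition q (i : 'I_3) : R * R :=
  match val i with
  | 0 => (1 / 2, Num.sqrt 3 / 2)
  | 1 => (0, 0)
  | _ => (1, 0)
  end.

Definition shift (i : 'I_3) : R * R :=
  match val i with
  | 0 => (1 / 4, Num.sqrt 3 / 4)
  | 1 => (0, 0)
  | _ => (1 / 2, 0)
  end.

Definition F (i : 'I_3) (x : R * R) : R * R :=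
  (1 / 2 * x.1 + (shift i).1, 1 / 2 * x.2 + (shift i).2).

Definition V0 : set (R * R) := range q.

Fixpoint V (m : nat) : set (R * R) :=
  if m is m'.+1 then \bigcup_(i : 'I_3) (F i @` V m') else V0.

(* Words are indexed from 0: [omega k] is the letter $\omega_{k+1}$.  Since the
   F i are bijections, $F_{\omega_1}^{-1}\cdots F_{\omega_m}^{-1}(A)$ is an
   iterated preimage. *)
Fixpoint blowup (omega : nat -> 'I_3) (m : nat) (A : set (R * R)) :
    set (R * R) :=
  if m is m'.+1 then blowup omega m' (F (omega m') @^-1` A) else A.

(* $F_{l_m}\cdots F_{l_1}(V_0)$ for l = [:: l_1; ...; l_m] *)
Definition cell (l : seq 'I_3) : set (R * R) :=
  foldl (fun A i => F i @` A) V0 l.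

Definition lattice (omega : nat -> 'I_3) : set (R * R) :=
  \bigcup_(m in [set m | (1 <= m)%N]) blowup omega m (V m).

Variable omega : nat -> 'I_3.

Definition neighbours (x : lattice omega) : set (lattice omega) :=
  [set y | x <> y /\
     exists m : nat, (1 <= m)%N /\
       exists l : m.-tuple 'I_3,
         blowup omega m (cell l) (val x) /\ blowup omega m (cell l) (val y)].

Definition boundary_point (x : lattice omega) : Prop :=
  (neighbours x #= `I_2)%card.

(* The sum over [neighbours x] is the library's finitely supported sum; every
   vertex of a lattice has finitely many neighbours. *)
Definition laplacian (f : lattice omega -> R[i]) : lattice omega -> R[i] :=
  fun x => \sum_(y \in neighbours x) f y - 4 * f x.

End SierpinskiLattice.

Arguments lattice R omega _ : clear implicits.
Arguments laplacian R omega f x : clear implicits.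

Section LpSpectrum.
Variables (R : realType) (X : choiceType) (p : R).

Definition lp_norm (f : X -> R[i]) : \bar R :=
  ((\esum_(x in [set: X]) (ComplexField.Normc.normc (f x) `^ p)%:E) `^ p^-1)%E.

Definition lp : set (X -> R[i]) := [set f | (lp_norm f < +oo)%E].

Definition lp_dense (A : set (X -> R[i])) : Prop :=
  forall g, lp g -> forall e : R, 0 < e ->
    exists2 f, A f & (lp_norm (fun x => f x - g x)%R < e%:E)%E.

Variable T : (X -> R[i]) -> (X -> R[i]).

(* $\lambda + T$: the sign is opposite to the usual $\lambda - T$. *)
Definition shifted (lambda : R[i]) (f : X -> R[i]) : X -> R[i] :=
  fun x => lambda * f x + T f x.

Definition point_spectrum : set R[i] :=
  [set lambda | ~ set_inj lp (shifted lambda)].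

Definition continuous_spectrum : set R[i] :=
  [set lambda | ~ point_spectrum lambda /\
     ~ set_surj lp lp (shifted lambda) /\ lp_dense (shifted lambda @` lp)].

Definition residue_spectrum : set R[i] :=
  [set lambda | ~ point_spectrum lambda /\
     ~ set_surj lp lp (shifted lambda) /\ ~ lp_dense (shifted lambda @` lp)].

End LpSpectrum.

Section Decimation.
Variable R : realType.

Definition decimation (z : R[i]) : R[i] := z * (5 - z).

(* For this polynomial the Julia set coincides with the set of points with
   bounded orbit (the filled Julia set). *)
Definition julia : set R[i] :=
  [set z | exists M : R, forall k : nat,
     ComplexField.Normc.normc (iter k decimation z) <= M].

Definition backward_orbit (a : R[i]) : set R[i] :=
  \bigcup_(m : nat) [set z | iter m decimation z = a].

Definition Sigma5 : set R[i] := backward_orbit 5.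

Definition Sigma6 : set R[i] := [set 6] `|` backward_orbit 3.

End Decimation.

Arguments julia R _ : clear implicits.
Arguments Sigma5 R _ : clear implicits.
Arguments Sigma6 R _ : clear implicits.

(* Main.v *)
(* Let N be the incidence operator from functions on the unit cells to functions on
   the vertices. Then 6 + Delta = N N^T, while N^T N = 3 + D with D the adjacency
   operator of the cubic graph of cells, so for lambda <> 6 the questions about
   lambda + Delta become questions about A = lambda - 3 + D. Cells are infinite words
   with the tail of omega. There A = a + P + E S, where a = lambda - 4, P is an
   involution exchanging neighbouring cells of different triples, S sums over the
   triples of cells and E is the pullback. Hence, unless lambda is 3 or 5, A is
   equivalent to the operator of the coarser graph at R(lambda), and at 3 and 5 there
   are eigenfunctions supported around a hole; this gives the eigenvalues. Off the
   Julia set the orbit of lambda becomes large, where A is inverted by iteration.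

   The Julia set is real and contained in [0,5]. Let lambda lie in it with an orbit
   avoiding 5, and let x be a cell. Decimating k times expresses f(x), for A f = 0,
   by the values of the coarse eigenfunction at the k-block z of x and at its three
   neighbours, with coefficients equivariant under the permutations of the letters.
   Symmetrizing over rotations and antisymmetrizing over transpositions turns this
   into an expression of f(x) by boundedly many values of f outside z, with bounded
   coefficients: the symmetric part because 3 - R^k(lambda) is bounded away from 0, the
   antisymmetric part because two corners of z are joined by a short path of blocks
   avoiding z, as soon as the word of x changes its letter at k. Since omega is not
   eventually constant, there are infinitely many such k. So eigenfunctions vanishing
   at infinity are 0; and averaging such expressions with disjoint supports, whose
   l^p norm tends to 0 because p > 1, puts every point mass in the closure of the range.

   Finally lambda is a limit of eigenvalues with localized eigenfunctions, so there is a
   u that vanishes at infinity, is not in l^p, but has A u in l^p; by the uniqueness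
   just proved A u is not in A(l^p). *)

Require Import Defs.
From mathcomp Require Import all_boot all_order all_algebra.
From mathcomp Require Import all_classical all_reals all_analysis.
From mathcomp Require Import complex.
From mathcomp Require Import perm ring lra zify.

Set Implicit Arguments.
Unset Strict Implicit.
Unset Printing Implicit Defensive.

Import Order.TTheory GRing.Theory Num.Theory.
Import ComplexField.Normc.

Local Open Scope classical_set_scope.
Local Open Scope ring_scope.
Local Open Scope complex_scope.

(** * Words and the cell graph *)

Definition word := nat -> 'I_3.

Definition scons (c : 'I_3) (z : word) : word :=
  fun n => if n is m.+1 then z m else c.

Definition tl (z : word) : word := fun n => z n.+1.

(* A word [l] with the same tail as [omega] encodes the cell
   $F_{\omega_1}^{-1}\cdots F_{\omega_m}^{-1}F_{l_m}\cdots F_{l_1}(V_0)$, $m$ large,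
   and [(l, j)] its corner with label [j]. The corner [(l, j)] is also the corner
   [twin l j] of a second cell, because $F_iF_j^n(q_j) = F_jF_i^n(q_i)$; the
   corner [(l, j)] of a constant word is left fixed. *)
Definition twin (l : word) (j : 'I_3) : word * 'I_3 :=
  match pselect (exists n, l n != j) with
  | left e => let n := ex_minn e in
      (fun m => if (m < n)%N then l n else if m == n then j else l m, l n)
  | right _ => (l, j)
  end.

Definition nb (l : word) (j : 'I_3) : word := (twin l j).1.

(** The corner labelled by the first letter is the one leading out of the triple of cells with the
    same tail, so this is the involution P. *)
Definition flip (l : word) : word := nb l (l 0).

Definition tail_eq (l l' : word) : Prop :=
  exists m, forall n, (m <= n)%N -> l n = l' n.

Definition stationary (l : word) : Prop :=
  exists m, forall n, (m <= n)%N -> l n = l m.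

Lemma tl_scons c z : tl (scons c z) = z.
Proof. by []. Qed.

Lemma scons_tl z : scons (z 0) (tl z) = z.
Proof. by apply/funext => -[|n]. Qed.

Lemma scons_inj c c' z z' : scons c z = scons c' z' -> c = c' /\ z = z'.
Proof.
move=> e; split; first by have := congr1 (fun f => f 0) e.
by rewrite -(tl_scons c z) e.
Qed.

Lemma twinE (l : word) j n : (forall m, (m < n)%N -> l m = j) -> l n != j ->
  twin l j =
  (fun m => if (m < n)%N then l n else if m == n then j else l m, l n).
Proof.
move=> lt_n ln; rewrite /twin; case: pselect => [e|ne]; last first.
  by exfalso; apply: ne; exists n.
case: ex_minnP => k lk kmin.
suff -> : k = n by [].
apply/eqP; rewrite eqn_leq kmin //=; rewrite leqNgt; apply/negP => /lt_n lkj.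
by rewrite lkj eqxx in lk.
Qed.

Lemma twin_const l j : (forall n, l n = j) -> twin l j = (l, j).
Proof.
move=> lj; rewrite /twin; case: pselect => // -[n p]; exfalso; by rewrite lj eqxx in p.
Qed.

Lemma twin_cases (l : word) (j : 'I_3) : (forall n, l n = j) \/
  exists2 n, (forall m, (m < n)%N -> l m = j) & l n != j.
Proof.
have [e|ne] := pselect (exists n, l n != j); last first.
  by left=> n; have [//|lm] := eqVneq (l n) j; exfalso; apply: ne; exists n.
right; case: (ex_minnP e) => n ln nmin; exists n => // m.
have [//|lm] := eqVneq (l m) j; by rewrite ltnNge nmin.
Qed.

Lemma twin_scons_neq c z j : c != j -> twin (scons c z) j = (scons j z, c).
Proof.
move=> cj; rewrite (@twinE _ _ 0) //=.
by congr (_, _); apply/funext => -[|n].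
Qed.

Lemma twin_scons_eq z j :
  twin (scons j z) j = (scons (twin z j).2 (twin z j).1, (twin z j).2).
Proof.
have [zj|[n lt_n zn]] := twin_cases z j.
  rewrite (twin_const zj) /= (@twin_const (scons j z)) //.
  by case.
rewrite (twinE lt_n zn) /= (@twinE _ _ n.+1) //=; last first.
  by case=> // m; rewrite ltnS; apply: lt_n.
by congr (_, _); apply/funext => -[|m].
Qed.

Lemma twinK l j : twin (twin l j).1 (twin l j).2 = (l, j).
Proof.
have [lj|[n lt_n ln]] := twin_cases l j.
  by rewrite (twin_const lj) /= (twin_const lj).
rewrite (twinE lt_n ln) /= (@twinE _ _ n) /=; last 2 first.
- by move=> m ->.
- by rewrite ltnn eqxx eq_sym.
congr (_, _); last by rewrite ltnn eqxx.
apply/funext => m; rewrite ltnn eqxx.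
by case: ltnP => [/lt_n//|_]; case: eqP => [->|].
Qed.

Lemma twin_fix l j : (twin l j).2 = j -> twin l j = (l, j).
Proof.
have [lj|[n lt_n ln]] := twin_cases l j; first by rewrite twin_const.
by rewrite (twinE lt_n ln) /= => e; rewrite e eqxx in ln.
Qed.

Lemma twin_flip x : twin x (x 0) = (flip x, flip x 0).
Proof.
rewrite /flip /nb; have [xj|[n lt_n xn]] := twin_cases x (x 0).
  by rewrite twin_const.
rewrite (twinE lt_n xn) /=; congr (_, _).
by case: n lt_n xn => [|n] //=; rewrite eqxx.
Qed.

Lemma flipK : involutive flip.
Proof.
move=> x; have := twinK x (x 0); rewrite twin_flip /= twin_flip.
by case.
Qed.

(** The cell [scons c z] occupies corner c of its triple; leaving through that corner leads into the
    triple of the neighbour of z at c. This is how fine cells see the adjacency of the coarser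
    graph. *)
Lemma tl_flip_scons c z : tl (flip (scons c z)) = nb z c.
Proof. by rewrite /flip /nb /= twin_scons_eq. Qed.

Lemma tl_flip x : tl (flip x) = nb (tl x) (x 0).
Proof. by rewrite -{1}(scons_tl x) tl_flip_scons. Qed.

Lemma nb_scons_neq c z j : c != j -> nb (scons c z) j = scons j z.
Proof. by move=> cj; rewrite /nb twin_scons_neq. Qed.

Lemma nb_scons_eq c z : nb (scons c z) c = flip (scons c z).
Proof. by []. Qed.

Lemma tail_eq_refl l : tail_eq l l. Proof. by exists 0%N. Qed.

Lemma tail_eq_sym l l' : tail_eq l l' -> tail_eq l' l.
Proof. by move=> [m e]; exists m => n /e. Qed.

Lemma tail_eq_trans l2 l1 l3 : tail_eq l1 l2 -> tail_eq l2 l3 -> tail_eq l1 l3.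
Proof.
move=> [m e] [m' e']; exists (maxn m m') => n.
by rewrite geq_max => /andP[/e -> /e' ->].
Qed.

Lemma tail_eq_nb l j : tail_eq (nb l j) l.
Proof.
rewrite /nb; have [lj|[n lt_n ln]] := twin_cases l j.
  by rewrite twin_const //; apply: tail_eq_refl.
rewrite (twinE lt_n ln) /=; exists n.+1 => m ltnm.
by rewrite ltnNge (ltnW ltnm) /= gtn_eqF.
Qed.

Lemma tail_eq_flip l : tail_eq (flip l) l.
Proof. exact: tail_eq_nb. Qed.

Lemma tail_eq_scons c c' l l' : tail_eq l l' -> tail_eq (scons c l) (scons c' l').
Proof. by move=> [m e]; exists m.+1 => -[//|n]; rewrite ltnS => /e. Qed.

Lemma iter_tlE k l n : iter k tl l n = l (k + n)%N.
Proof.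
elim: k n => [//|k IH] n; by rewrite iterS {1}/tl IH addnS.
Qed.

Lemma tail_eq_iter l l' : tail_eq l l' ->
  exists K, forall k, (K <= k)%N -> iter k tl l = iter k tl l'.
Proof.
move=> [m e]; exists m => k mk; apply/funext => n.
by rewrite !iter_tlE e // (leq_trans mk) ?leq_addr.
Qed.

Lemma stationary_tail l l' : tail_eq l l' -> stationary l -> stationary l'.
Proof.
move=> [m e] [k s]; exists (maxn m k) => n; rewrite geq_max => /andP[mn kn].
by rewrite -!e ?leq_maxl // s // [RHS]s // leq_maxr.
Qed.

Lemma third_letter (a b : 'I_3) : a != b ->
  exists c, [/\ c != a, c != b & forall d : 'I_3, [|| d == a, d == b | d == c]].
Proof.
rewrite -val_eqE /= => ab; exists (inord (3 - a - b)).
have ? := ltn_ord a; have ? := ltn_ord b.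
have lt3 : (3 - a - b < 3)%N by lia.
rewrite -!val_eqE /= inordK //; split; try lia.
by move=> d; have ? := ltn_ord d; rewrite -!val_eqE /= inordK //; lia.
Qed.

Lemma sum_letters (V : zmodType) (a b c : 'I_3) (F : 'I_3 -> V) :
  a != b -> c != a -> c != b -> \sum_d F d = F a + F b + F c.
Proof.
move=> ab ca cb; rewrite (bigD1 a) //= (bigD1 b) /= 1?eq_sym //.
rewrite (bigD1 c) /= ?ca ?cb // big1 ?addr0 ?addrA // => d.
move: ab ca cb; rewrite -!val_eqE /=.
have ? := ltn_ord a; have ? := ltn_ord b; have ? := ltn_ord c.
have ? := ltn_ord d; lia.
Qed.

(** * The cell operator and spectral decimation *)

Section CellOperator.
Variable R : realType.
Local Notation C := (R[i]).
Implicit Types (f g : word -> C) (a : C).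

Definition fsum f : word -> C := fun z => \sum_c f (scons c z).

(* [cellop (lambda - 4)] is $\lambda - 3 + D$, with $D$ the adjacency operator
   of the cell graph. *)
Definition cellop a f : word -> C :=
  fun x => a * f x + f (flip x) + fsum f (tl x).

(* The decimation map in the variable [a = lambda - 4]. *)
Definition dec a : C := - (a * (a + 3)).

Lemma sum_nb f z : \sum_d f (nb z d) = f (flip z) + fsum f (tl z) - f z.
Proof.
rewrite -(scons_tl z) /fsum tl_scons.
set c := z 0; set y := tl z.
rewrite (bigD1 c) //= nb_scons_eq [X in _ + X - _](bigD1 c) //=.
rewrite (eq_bigr (fun d => f (scons d y))); last first.
  by move=> d dc; rewrite nb_scons_neq // eq_sym.
by ring.
Qed.

Lemma cellop_nb a f z : cellop a f z = (a + 1) * f z + \sum_d f (nb z d).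
Proof. by rewrite sum_nb /cellop; ring. Qed.

(** Applying a - P to a + P + E S turns the first two terms into the scalar a^2 - 1, because P is an
    involution. Unless a^2 = 1, f is thus determined by [cellop a f] and the triple sums. *)
Lemma cellop_solve a f x : a * cellop a f x - cellop a f (flip x) =
  (a ^+ 2 - 1) * f x + a * fsum f (tl x) - fsum f (nb (tl x) (x 0)).
Proof. by rewrite /cellop flipK tl_flip; ring. Qed.

(** Spectral decimation: summed over a triple, [cellop_solve] involves f only through [fsum f], with
    the coefficients of the coarser operator at [dec a]. *)
Lemma cellop_fsum a f z : cellop (dec a) (fsum f) z =
  - \sum_c (a * cellop a f (scons c z) - cellop a f (flip (scons c z))).
Proof.
under eq_bigr do rewrite cellop_solve tl_scons /=.
rewrite !sumrB big_split /= -mulr_sumr sum_nb.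
rewrite sumr_const card_ord /cellop /dec -/(fsum f z).
by rewrite -mulr_natr; ring.
Qed.

(** * Functionals modulo the range of the cell operator *)

(* [l] is the pairing with an element [A g] of the range of the symmetric
   operator [A := cellop a], for a finitely supported [g]. *)
Definition null a (l : (word -> C) -> C) : Prop :=
  exists e : seq (C * word), forall f, l f = \sum_(t <- e) t.1 * cellop a f t.2.

Lemma null_ext a l l' : l =1 l' -> null a l -> null a l'.
Proof. by move=> ll' [e he]; exists e => f; rewrite -ll'. Qed.

Lemma null0 a : null a (fun=> 0).
Proof. by exists [::] => f; rewrite big_nil. Qed.

Lemma null_cellop a x : null a (fun f => cellop a f x).
Proof. by exists [:: (1, x)] => f; rewrite big_seq1 mul1r. Qed.

Lemma nullD a l l' : null a l -> null a l' -> null a (fun f => l f + l' f).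
Proof.
by move=> [e he] [e' he']; exists (e ++ e') => f; rewrite big_cat he he'.
Qed.

Lemma nullZ a c l : null a l -> null a (fun f => c * l f).
Proof.
move=> [e he]; exists [seq (c * t.1, t.2) | t <- e] => f.
by rewrite he mulr_sumr big_map /=; apply: eq_bigr => t _; rewrite mulrA.
Qed.

Lemma null_sum a (I : Type) (r : seq I) (l : I -> (word -> C) -> C) :
  (forall i, null a (l i)) -> null a (fun f => \sum_(i <- r) l i f).
Proof.
move=> hl; elim: r => [|i r IH].
  by apply: null_ext (null0 a) => f; rewrite big_nil.
by apply: null_ext (nullD (hl i) IH) => f; rewrite big_cons.
Qed.

Lemma null_fsum a l : null (dec a) l -> null a (fun f => l (fsum f)).
Proof.
move=> [e he].
pose F t f := t.1 * cellop (dec a) (fsum f) t.2.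
apply: (@null_ext _ (fun f => \sum_(t <- e) F t f)); first by move=> f; rewrite he.
apply: null_sum => t; apply: nullZ.
pose G c f : C := (- a) * cellop a f (scons c t.2) + cellop a f (flip (scons c t.2)).
apply: (@null_ext _ (fun f => \sum_c G c f)).
  move=> f; rewrite cellop_fsum -sumrN; apply: eq_bigr => c _.
  by rewrite /G; ring.
apply: null_sum => c; apply: nullD; last exact: null_cellop.
by apply: nullZ; apply: null_cellop.
Qed.

Lemma null_iter a k l : null (iter k dec a) l ->
  null a (fun f => l (iter k fsum f)).
Proof.
elim: k l => [|k IH] l hl //.
have /IH := null_fsum hl.
by apply: null_ext => f; rewrite /=.
Qed.

Lemma null_solve a k x : null a (fun f =>
  (iter k dec a ^+ 2 - 1) * iter k fsum f x
  + iter k dec a * iter k.+1 fsum f (tl x)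
  - iter k.+1 fsum f (nb (tl x) (x 0))).
Proof.
pose b := iter k dec a.
pose l f := b * cellop b f x + -1 * cellop b f (flip x).
have hl : null b l by apply: nullD; apply: nullZ; apply: null_cellop.
apply: null_ext (null_iter hl) => f.
by rewrite /l mulN1r cellop_solve.
Qed.

(* [place [:: c_k; ...; c_1] z] is the word $c_1\cdots c_kz$. *)
Fixpoint place (w : seq 'I_3) (z : word) : word :=
  if w is c :: w' then place w' (scons c z) else z.

Lemma iter_tl_place w z : iter (size w) tl (place w z) = z.
Proof. by elim: w z => [//|c w IH] z; rewrite iterS IH. Qed.

Lemma place_iter_tl k x : exists2 w, size w = k & x = place w (iter k tl x).
Proof.
elim: k => [|k [w sw {1}->]]; first by exists [::].
exists (iter k tl x 0 :: w); rewrite /= ?sw //.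
by rewrite scons_tl.
Qed.

(* The coefficients expressing the value of a $\lambda$-eigenfunction at a cell
   of the block of address [w] by the values of the coarser eigenfunction at
   this block and at its three neighbours. *)
Fixpoint blockcoef a (w : seq 'I_3) : C * ('I_3 -> C) :=
  if w is c :: w' then
    let: (al, be) := blockcoef a w' in
    let b := iter (size w') dec a in
    ((be c - b * (al + \sum_d be d - be c)) / (b ^+ 2 - 1),
     fun d => (if d == c then al - b * be c else be d) / (b ^+ 2 - 1))
  else (1, fun=> 0).

Local Notation alpha a w := (blockcoef a w).1.
Local Notation beta a w := (blockcoef a w).2.

(** The recursion uses letters only through comparisons and sums over all letters, so it commutes
    with relabelling. *)
Lemma blockcoef_map a w (s : 'I_3 -> 'I_3) : injective s ->
  alpha a (map s w) = alpha a w /\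
  forall c, beta a (map s w) (s c) = beta a w c.
Proof.
move=> sI; elim: w => [//|c w] /=.
case: (blockcoef a w) => al be; case: (blockcoef a (map s w)) => al' be' /= [-> hbe].
have -> : \sum_d be' d = \sum_d be d.
  by rewrite (reindex_inj sI); apply: eq_bigr => d _; rewrite hbe.
rewrite hbe size_map; split=> // d.
by rewrite (inj_eq sI) hbe.
Qed.

(** Induction on the level: the values of the level-k function at [scons c z] and at its three
    neighbours are traded for values one level up by [null_solve], dividing by b^2 - 1. *)
Lemma block_expand a w z :
  (forall k, (k < size w)%N -> iter k dec a ^+ 2 != 1) ->
  null a (fun f => f (place w z) - alpha a w * iter (size w) fsum f z
    - \sum_c beta a w c * iter (size w) fsum f (nb z c)).
Proof.
elim: w z => [|c w IH] z good.
  apply: null_ext (null0 a) => f /=; rewrite big1 ?mul1r; first by ring.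
  by move=> d _; rewrite mul0r.
have {}IH := IH (scons c z) (fun k h => good k (ltnW h)).
have b1 := good (size w) (ltnSn _).
move: IH; rewrite /=.
case: (blockcoef a w) => al be /=.
set k := size w in b1 *; set b := iter k dec a in b1 *.
have b10 : b ^+ 2 - 1 != 0 by rewrite subr_eq0.
have N y := null_solve a k y.
have [d [e [cd ec ed]]] : exists d e : 'I_3,
    [/\ c != d, e != c & e != d].
  have cd : c != c + 1 by rewrite -subr_eq0 opprD addNKr oppr_eq0.
  by have [e [ec ed _]] := third_letter cd; exists (c + 1), e.
have dc : d != c by rewrite eq_sym.
have ce : c != e by rewrite eq_sym.
move=> IH; apply: null_ext (nullD IH
  (nullD (nullZ (al / (b ^+ 2 - 1)) (N (scons c z)))
  (nullD (nullZ (be c / (b ^+ 2 - 1)) (N (flip (scons c z))))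
  (nullD (nullZ (be d / (b ^+ 2 - 1)) (N (scons d z)))
     (nullZ (be e / (b ^+ 2 - 1)) (N (scons e z))))))) => f.
rewrite -!/b !tl_scons !tl_flip_scons /= -/(nb z c).
have -> : nb (nb z c) (flip (scons c z) 0) = z.
  by rewrite -(tl_flip_scons c z) -tl_flip flipK tl_scons.
rewrite !(sum_letters _ cd ec ed) nb_scons_eq !nb_scons_neq //.
rewrite eqxx (negbTE dc) (negbTE ec).
by field.
Qed.

End CellOperator.

Arguments dec {R} a.
Arguments fsum {R} f z.
Arguments cellop {R} a f x.

(** * Representing a point evaluation off its block *)

Section Representation.
Variable R : realType.
Local Notation C := (R[i]).
Implicit Types (f g : word -> C) (a : C).
Local Notation alpha a w := (blockcoef a w).1.
Local Notation beta a w := (blockcoef a w).2.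

Lemma normc_ge0 (z : C) : 0 <= normc z.
Proof. by case: z => u v; apply: sqrtr_ge0. Qed.

(* Modulo the range of [cellop a], the functional [l] is a combination of point
   evaluations at points of [Q], with coefficients of total mass at most [M]. *)
Definition rep a (Q : word -> Prop) (M : R) (l : (word -> C) -> C) : Prop :=
  exists s : seq (C * word),
    [/\ forall t, t \in s -> Q t.2, \sum_(t <- s) normc t.1 <= M &
        null a (fun f => l f - \sum_(t <- s) t.1 * f t.2)].

Lemma rep_ext a Q M l l' : l =1 l' -> rep a Q M l -> rep a Q M l'.
Proof.
move=> ll' [s [sQ sM sl]]; exists s; split=> //.
by apply: null_ext sl => f; rewrite ll'.
Qed.

Lemma rep_null a Q l : null a l -> rep a Q 0 l.
Proof.
move=> hl; exists [::]; split=> //; first by rewrite big_nil.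
by apply: null_ext hl => f; rewrite big_nil subr0.
Qed.

Lemma rep_pt a (Q : word -> Prop) x : Q x -> rep a Q 1 (fun f => f x).
Proof.
move=> Qx; exists [:: (1, x)]; split.
- by move=> t; rewrite inE => /eqP ->.
- by rewrite big_seq1 normc1.
- by apply: null_ext (null0 a) => f; rewrite big_seq1 mul1r subrr.
Qed.

Lemma repD a Q M1 M2 l1 l2 : rep a Q M1 l1 -> rep a Q M2 l2 ->
  rep a Q (M1 + M2) (fun f => l1 f + l2 f).
Proof.
move=> [s1 [Q1 h1 n1]] [s2 [Q2 h2 n2]]; exists (s1 ++ s2); split.
- by move=> t; rewrite mem_cat => /orP[/Q1|/Q2].
- by rewrite big_cat lerD.
- by apply: null_ext (nullD n1 n2) => f; rewrite big_cat /=; ring.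
Qed.

Lemma repZ a Q M c l : rep a Q M l -> rep a Q (normc c * M) (fun f => c * l f).
Proof.
move=> [s [sQ sM sl]]; exists [seq (c * t.1, t.2) | t <- s]; split.
- by move=> t /mapP[u us ->]; apply: (sQ u).
- rewrite big_map /=; under eq_bigr do rewrite normcM.
  by rewrite -mulr_sumr ler_wpM2l // normc_ge0.
- apply: null_ext (nullZ c sl) => f.
  rewrite big_map mulrBr mulr_sumr; congr (_ - _).
  by apply: eq_bigr => t _; rewrite mulrA.
Qed.

Lemma rep_sum a Q M (r : seq 'I_3) (l : 'I_3 -> (word -> C) -> C) :
  (forall i, rep a Q M (l i)) ->
  rep a Q (M *+ size r) (fun f => \sum_(i <- r) l i f).
Proof.
move=> hl; elim: r => [|i r IH].
  by apply: rep_null; apply: null_ext (null0 a) => f; rewrite big_nil.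
rewrite /= mulrS; apply: rep_ext (repD (hl i) IH) => f.
by rewrite big_cons.
Qed.

Lemma rep_le a Q M M' l : M <= M' -> rep a Q M l -> rep a Q M' l.
Proof. by move=> MM' [s [sQ sM sl]]; exists s; split=> //; apply: le_trans MM'. Qed.

Lemma flip_scons2 (c d : 'I_3) z : c != d ->
  flip (scons c (scons d z)) = scons d (scons c z).
Proof.
by move=> cd; rewrite -nb_scons_eq /nb twin_scons_eq twin_scons_neq // eq_sym.
Qed.

(** * Symmetrized expansions over a block *)

Section Block.
Variables (a : C) (w : seq 'I_3).
Hypothesis good : forall k, (k < size w)%N -> iter k dec a ^+ 2 != 1.

Local Notation k := (size w).
Local Notation b := (iter k dec a).
Local Notation F f := (iter k fsum f).

Let null_level x : null a (fun f => (b + 1) * F f x + \sum_d F f (nb x d)).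
Proof.
by apply: null_ext (null_iter (null_cellop b x)) => f; rewrite cellop_nb.
Qed.

(** What remains at the block after the three rotated cells are added and the values at its
    neighbours are eliminated by the coarse equation. *)
Let kappa := 3 * alpha a w - (b + 1) * \sum_d beta a w d.

Lemma null_rotations y : null a (fun f =>
  \sum_(t : 'I_3) f (place (map (+%R^~ t) w) y) - kappa * F f y).
Proof.
have h (t : 'I_3) : null a (fun f => f (place (map (+%R^~ t) w) y)
    - alpha a w * F f y - \sum_c beta a w (c - t) * F f (nb y c)).
  have [ha hb] := blockcoef_map a w (@addIr _ t).
  have g : forall j, (j < size (map (+%R^~ t) w))%N -> iter j dec a ^+ 2 != 1.
    by rewrite size_map.
  have := block_expand y g; rewrite size_map ha; apply: null_ext => f.
  by congr (_ - _); apply: eq_bigr => c _; rewrite -hb subrK.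
apply: null_ext (nullD (null_sum (index_enum 'I_3) h)
  (nullZ (\sum_d beta a w d) (null_level y))) => f.
rewrite !sumrB.
have -> : \sum_(t < 3) \sum_(c < 3) beta a w (c - t) * F f (nb y c) =
    (\sum_d beta a w d) * \sum_c F f (nb y c).
  rewrite exchange_big mulr_sumr; apply: eq_bigr => c _.
  rewrite -mulr_suml; congr (_ * _).
  rewrite [RHS](reindex_inj (h := fun t => c - t)) //.
  by move=> u v /addrI /oppr_inj.
rewrite sumr_const card_ord /kappa -mulr_natr.
by ring.
Qed.

(** One cell arises from the other by exchanging the letters i' and j'. Their expansions agree at
    the block and at the third neighbour, so only the neighbours at i' and j' survive in the
    difference. *)
Lemma null_swap (i j i' j' : 'I_3) : i != j -> i' != j' ->
  exists w1 w2, [/\ size w1 = k, size w2 = k &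
  forall y, null a (fun f =>
    (beta a w i - beta a w j) * (F f (nb y i') - F f (nb y j'))
    - (f (place w1 y) - f (place w2 y)))].
Proof.
move=> ij ij'.
have [s sI [si sj]] : exists2 s : 'I_3 -> 'I_3, injective s & s i = i' /\ s j = j'.
  exists (tperm (tperm i i' j) j' \o tperm i i').
    exact: inj_comp (@perm_inj _ _) (@perm_inj _ _).
  rewrite /= tpermL tpermD ?tpermL ?tpermR //; last by rewrite eq_sym.
  apply/eqP => h; move/eqP: ij; apply; apply: (@perm_inj _ (tperm i i')).
  by rewrite tpermL.
pose t := tperm i' j'.
have tI : injective t := @perm_inj _ t.
exists (map s w), (map t (map s w)); rewrite !size_map; split=> // y.
have g (u : seq 'I_3) : size u = k -> forall j, (j < size u)%N -> iter j dec a ^+ 2 != 1.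
  by move=> ->.
have [h1a h1b] := blockcoef_map a w sI.
have [h2a h2b] := blockcoef_map a (map s w) tI.
have [c [ci cj _]] := third_letter ij'.
have n1 := block_expand y (g _ (size_map s w)).
have s2 : size (map t (map s w)) = k by rewrite !size_map.
have n2 := block_expand y (g _ s2).
move: n1 n2; rewrite s2 size_map => n1 n2.
apply: null_ext (nullD n2 (nullZ (-1) n1)) => f.
rewrite !(sum_letters _ ij' ci cj).
have -> : beta a (map t (map s w)) i' = beta a (map s w) j'.
  by rewrite -h2b tpermR.
have -> : beta a (map t (map s w)) j' = beta a (map s w) i'.
  by rewrite -h2b tpermL.
have -> : beta a (map t (map s w)) c = beta a (map s w) c.
  by rewrite -h2b tpermD // eq_sym.
rewrite h2a -si -sj !h1b.
by ring.
Qed.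

Section OffBlock.
Variables (x : word) (l1 l2 : 'I_3) (r : word).
Local Notation z := (scons l1 (scons l2 r)).
Hypothesis l12 : l1 != l2.

Definition off_block y : Prop := iter k tl y <> z /\ tail_eq (iter k tl y) z.

Lemma off_place w' i j : size w' = k -> ~~ ((i == l1) && (j == l2)) ->
  off_block (place w' (scons i (scons j r))).
Proof.
move=> sw ne; rewrite /off_block -sw iter_tl_place; split.
  move=> /scons_inj[e1 /scons_inj[e2 _]].
  by rewrite e1 e2 !eqxx in ne.
by do 2!apply: tail_eq_scons; apply: tail_eq_refl.
Qed.

Lemma rep_kappa i j : ~~ ((i == l1) && (j == l2)) ->
  rep a off_block 3 (fun f => kappa * F f (scons i (scons j r))).
Proof.
move=> ne; set y := scons i _.
have h t : rep a off_block 1 (fun f => f (place (map (+%R^~ t) w) y)).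
  by apply: rep_pt; apply: off_place; rewrite ?size_map.
have H := rep_sum (index_enum 'I_3) h.
have := repD H (rep_null off_block (nullZ (-1) (null_rotations y))).
rewrite addr0 (_ : size (index_enum 'I_3) = 3%N); last first.
  by rewrite -[RHS](card_ord 3) cardE enumT.
by apply: rep_ext => f; ring.
Qed.

Lemma rep_dif i j i' j' c d : i != j -> i' != j' ->
  ~~ ((c == l1) && (d == l2)) ->
  rep a off_block 2 (fun f => (beta a w i - beta a w j) *
    (F f (nb (scons c (scons d r)) i') - F f (nb (scons c (scons d r)) j'))).
Proof.
move=> ij ij' ne; set y := scons c _.
have [w1 [w2 [s1 s2 n12]]] := null_swap ij ij'.
have r1 := @rep_pt a _ _ (off_place s1 ne).
have r2 := @rep_pt a _ _ (off_place s2 ne).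
have := repD (repD r1 (repZ (-1) r2)) (rep_null off_block (n12 y)).
rewrite normcN normc1 mul1r addr0.
by apply: rep_ext => f; ring.
Qed.

(* Two vertices of the block of address [w] are joined by a path of blocks
   avoiding it: around the triangle of cells through [z], or around the hexagon
   of cells surrounding the next larger hole. *)
Lemma rep_off_block : 1 / 2 <= normc (b + 1) ->
  rep a off_block 16 (fun f => f (place w z)).
Proof.
move=> b1.
have l21 : l2 != l1 by rewrite eq_sym.
have [l3 [l31 l32 _]] := third_letter l12.
have l13 : l1 != l3 by rewrite eq_sym.
have l23 : l2 != l3 by rewrite eq_sym.
have bn0 : b + 1 != 0.
  by apply: contraTneq b1 => ->; rewrite normc0 -ltNge; lra.
(* Each of the two other blocks of the triangle through z contributes the difference of its two
   neighbours on the triangle; the value at z itself cancels. *)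
have triangle i j : i != j -> rep a off_block 4 (fun f =>
    (beta a w i - beta a w j) * (F f (nb z l2) - F f (nb z l3))).
  move=> ij.
  have h1 : rep a off_block 2 _ := @rep_dif i j l1 l3 l2 l2 ij l13 _.
  have h2 : rep a off_block 2 _ := @rep_dif i j l2 l1 l3 l2 ij l21 _.
  rewrite (negbTE l21) (negbTE l31) /= in h1 h2.
  rewrite (_ : 4 = 2 + 2); last by ring.
  apply: rep_ext (repD (h1 isT) (h2 isT)) => f.
  by rewrite !nb_scons_neq //; ring.
(* Likewise the five other blocks of the hexagon each contribute the difference of their two
   neighbours on it, and the sum telescopes. *)
have hexagon i j : i != j -> rep a off_block 10 (fun f =>
    (beta a w i - beta a w j) * (F f (nb z l1) - F f (nb z l3))).
  move=> ij.
  have h1 : rep a off_block 2 _ := @rep_dif i j l2 l3 l2 l1 ij l23 _.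
  have h2 : rep a off_block 2 _ := @rep_dif i j l2 l3 l3 l1 ij l23 _.
  have h3 : rep a off_block 2 _ := @rep_dif i j l1 l2 l1 l3 ij l12 _.
  have h4 : rep a off_block 2 _ := @rep_dif i j l1 l2 l2 l3 ij l12 _.
  have h5 : rep a off_block 2 _ := @rep_dif i j l3 l1 l3 l2 ij l31 _.
  rewrite (negbTE l21) (negbTE l31) (negbTE l32) ?andbF /= in h1 h2 h3 h4 h5.
  rewrite (_ : 10 = 2 + (2 + (2 + (2 + 2)))); last by ring.
  apply: rep_ext (repD (h1 isT) (repD (h2 isT) (repD (h3 isT)
    (repD (h4 isT) (h5 isT))))) => f.
  rewrite !nb_scons_eq !flip_scons2 // !nb_scons_neq //.
  by ring.
(* The equation at z replaces its value by those at the three neighbours, each of mass 3 after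
   multiplication by [kappa]; dividing by b + 1 at most doubles the total 9. *)
have center : rep a off_block 18 (fun f => kappa * F f z).
  have h1 := @rep_kappa l2 l1; have h2 := @rep_kappa l2 l2.
  have h3 := @rep_kappa l3 l2.
  rewrite (negbTE l21) (negbTE l31) /= in h1 h2 h3.
  have := repD (repZ (- (b + 1)^-1) (repD (h1 isT) (repD (h2 isT) (h3 isT))))
    (rep_null off_block (nullZ (kappa / (b + 1)) (null_level z))).
  move=> /(rep_le (M' := 18)) h; apply: rep_ext (h _) => [f|].
    rewrite (sum_letters _ l12 l31 l32) nb_scons_eq flip_scons2 //.
    rewrite !nb_scons_neq //.
    by field.
  rewrite normcN normcV addr0.
  have : (normc (b + 1))^-1 <= 2.
    rewrite -[2]invrK lef_pV2 ?posrE ?invr_gt0 //; first lra.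
    by apply: lt_le_trans b1; lra.
  lra.
(* The equation at z turns the expansion into kappa / 3 times the value at z plus the neighbour
   values weighted by beta minus its mean. The latter part is one third of the differences below;
   the mass is 18 / 3 + 28 / 3 < 16. *)
have n := nullD (block_expand z good)
  (nullZ ((\sum_d beta a w d) / 3) (null_level z)).
have := repD (rep_null off_block n) (repD (repZ (1 / 3) center)
  (repZ (1 / 3) (repD (repD (hexagon _ _ l12)
    (repZ (-1) (triangle _ _ l12))) (repD (hexagon _ _ l13) (triangle _ _ l23))))).
move=> /(rep_le (M' := 16)) h; apply: rep_ext (h _) => [f|].
  rewrite !(sum_letters _ l12 l31 l32) /kappa.
  by rewrite !(sum_letters _ l12 l31 l32); field.
rewrite !normcN normc1 mul1r normcV.
have -> : normc (3 : C) = 3 by have := normcMn (1 : C) 3; rewrite normc1.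
lra.
Qed.

End OffBlock.
End Block.
End Representation.

(** * The Julia set of the decimation map *)

Section Dynamics.
Variable R : realType.
Local Notation C := (R[i]).

Definition rdec (x : R) : R := x * (5 - x).

Lemma normc_real (x : R) : normc (x%:C) = `|x|.
Proof. by rewrite /normc /= expr0n addr0 sqrtr_sqr. Qed.

Lemma Re_decimation (z : C) : complex.Re (decimation z) =
  complex.Re z * (5 - complex.Re z) + complex.Im z ^+ 2.
Proof. by case: z => u v; rewrite /decimation /=; ring. Qed.

Lemma Im_decimation (z : C) : complex.Im (decimation z) =
  complex.Im z * (5 - 2 * complex.Re z).
Proof. by case: z => u v; rewrite /decimation /=; ring. Qed.

Lemma decimation_real (x : R) k :
  iter k (@decimation R) x%:C = (iter k rdec x)%:C.
Proof.
elim: k => [//|k IH]; rewrite !iterS IH; set y := iter k rdec x.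
apply/eqP; rewrite eq_complex Re_decimation Im_decimation /= /rdec.
by apply/andP; split; apply/eqP; ring.
Qed.

Lemma iter_dec (z : C) k : iter k dec (z - 4) = iter k (@decimation R) z - 4.
Proof.
elim: k => [//|k IH]; rewrite !iterS IH /dec /decimation.
by ring.
Qed.

Lemma nat_above (B : R) : exists n : nat, B < n%:R.
Proof.
exists (Num.bound `|B|); apply: le_lt_trans (ler_norm B) _.
exact: archi_boundP.
Qed.

Lemma bounded_growth (x : nat -> R) (B : R) :
  (forall k, 0 < x k -> 5 * x k <= x k.+1) -> (forall k, x k <= B) ->
  x 0%N <= 0.
Proof.
move=> grow bnd; rewrite leNgt; apply/negP => x0.
have h k : k.+1%:R * x 0%N <= x k.
  elim: k => [|k IH]; first by rewrite mul1r.
  have : (0 : R) <= k%:R by [].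
  have := grow k; move: IH; rewrite -2![in X in _ -> _ -> _ -> X]natr1 -natr1.
  nra.
have [n hn] := nat_above (B / x 0%N).
have := h n; have := bnd n; rewrite -natr1.
have : B < n%:R * x 0%N by rewrite -ltr_pdivrMr.
nra.
Qed.

(** In w = z - 5/2 the map is w -> 15/4 - w^2. An orbit leaving the disc with diameter [0,5]
    escapes, and inside the disc a nonzero imaginary part would grow without bound. *)
Lemma julia_real (z : C) : julia R z ->
  exists2 x : R, z = x%:C & forall k, 0 <= iter k rdec x <= 5.
Proof.
move=> [M hM].
pose u k := complex.Re (iter k (@decimation R) z).
pose v k := complex.Im (iter k (@decimation R) z).
have uS k : u k.+1 = u k * (5 - u k) + v k ^+ 2 by rewrite /u iterS Re_decimation.
have vS k : v k.+1 = v k * (5 - 2 * u k) by rewrite /v iterS Im_decimation.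
have nM k : u k ^+ 2 + v k ^+ 2 <= M ^+ 2.
  have M0 : 0 <= M by apply: le_trans (hM 0%N); apply: normc_ge0.
  have := hM k; rewrite -(ler_sqr _ M0) ?nnegrE ?normc_ge0 //.
  rewrite /u /v; case: (iter k _ z) => p q /=.
  by rewrite sqr_sqrtr // addr_ge0 // sqr_ge0.
(* Positive values of d mean that the orbit has left the disc; the next value is then at least d^2 +
   5 d. *)
pose d k := (u k - 5 / 2) ^+ 2 + v k ^+ 2 - 25 / 4.
have d_le k : d k <= 0.
  rewrite -[k]addn0; apply: (@bounded_growth (fun j => d (k + j)%N) (2 * M ^+ 2 + 50)) => j.
    rewrite addnS /d uS vS; set p := u _; set q := v _ => d0.
    set m := (p - 5 / 2) ^+ 2 + q ^+ 2 in d0 *.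
    have : (m - 15 / 4) ^+ 2 <=
       (p * (5 - p) + q ^+ 2 - 5 / 2) ^+ 2 + (q * (5 - 2 * p)) ^+ 2.
      have : 0 <= q ^+ 2 by apply: sqr_ge0.
      have -> : (p * (5 - p) + q ^+ 2 - 5 / 2) ^+ 2 + (q * (5 - 2 * p)) ^+ 2 =
         (m - 15 / 4) ^+ 2 + 15 * q ^+ 2 by rewrite /m; field.
      lra.
    nra.
  have := nM (k + j)%N; rewrite /d.
  set p := u _; set q := v _.
  have : 0 <= (p + 5) ^+ 2 by apply: sqr_ge0.
  have : 0 <= q ^+ 2 by apply: sqr_ge0.
  have : 0 <= p ^+ 2 by apply: sqr_ge0.
  nra.
(* The next point lies in the disc, so its real part is at most 5, which bounds the real part of w^2
   from below. Hence the squared imaginary part grows at least by 4 * 5/4 = 5. *)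
have sep k : 5 / 4 <= (u k - 5 / 2) ^+ 2 - v k ^+ 2.
  have := d_le k.+1; rewrite /d uS vS.
  set p := u k; set q := v k => h.
  have : 0 <= (q * (5 - 2 * p)) ^+ 2 by apply: sqr_ge0.
  nra.
have v0 k : v k = 0.
  apply/eqP; rewrite -sqrf_eq0 eq_le sqr_ge0 andbT.
  rewrite -[k]addn0; apply: (@bounded_growth (fun j => v (k + j)%N ^+ 2) (25 / 4)) => j.
    rewrite addnS vS => _; have := sep (k + j)%N.
    set p := u _; set q := v _.
    have : 0 <= q ^+ 2 by apply: sqr_ge0.
    have -> : (q * (5 - 2 * p)) ^+ 2 = 4 * q ^+ 2 * (p - 5 / 2) ^+ 2 by field.
    nra.
  have := d_le (k + j)%N; rewrite /d; set p := u _; set q := v _.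
  have : 0 <= (p - 5 / 2) ^+ 2 by apply: sqr_ge0.
  lra.
have zE : z = (u 0%N)%:C.
  by apply/eqP; rewrite eq_complex eqxx /= -/(v 0%N) v0.
exists (u 0%N) => // k.
have -> : iter k rdec (u 0%N) = u k.
  by rewrite [in RHS]/u zE decimation_real.
have := d_le k; rewrite /d v0; set p := u k; nra.
Qed.

Lemma rdec_separation (x : R) : rdec x <= 5 -> 5 / 4 <= (x - 5 / 2) ^+ 2.
Proof. by rewrite /rdec; nra. Qed.

(** The gap around 5/2 given by [rdec_separation] has half width sqrt 5 / 2 > 1, and 3 is only 1/2
    away from its centre. *)
Lemma rdec_away3 (x : R) : rdec x <= 5 -> 1 / 2 <= `|x - 3|.
Proof.
move=> /rdec_separation h; rewrite leNgt ltr_norml; apply/negP => /andP[]; nra.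
Qed.

(** In the variable a = lambda - 4 the values 1 and -1 stand for 5, excluded by hypothesis, and 3,
    which lies in the gap. *)
Lemma orbit_good (z : C) k : julia R z -> ~ Sigma5 R z ->
  iter k dec (z - 4) ^+ 2 != 1 /\ 1 / 2 <= normc (iter k dec (z - 4) + 1).
Proof.
move=> Jz z5; have [x zx hx] := julia_real Jz.
rewrite iter_dec zx decimation_real.
have := hx k.+1; rewrite iterS => /andP[_ hk].
have [y hy] : exists y, y = iter k rdec x by exists (iter k rdec x).
rewrite -hy in hk *.
have n3 := rdec_away3 hk.
have e : y%:C - 4 + 1 = (y - 3)%:C :> C.
  by rewrite rmorphB /= !rmorph_nat; ring.
rewrite e normc_real; split=> //.
have -> : y%:C - 4 = (y - 4)%:C :> C by rewrite rmorphB /= !rmorph_nat.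
rewrite -rmorphXn -(rmorph1 (@real_complex R)) (inj_eq (@complexI R)).
rewrite sqrf_eq1 negb_or; apply/andP; split; apply/eqP => h.
  apply: z5; exists k => //=; rewrite zx decimation_real -hy.
  by rewrite (_ : y = 5) ?rmorph_nat //; lra.
by move: n3; rewrite (_ : y = 3) ?subrr ?normr0; lra.
Qed.

End Dynamics.

Lemma tail_eq_iterI k l l' : tail_eq (iter k tl l) (iter k tl l') -> tail_eq l l'.
Proof.
move=> [m e]; exists (k + m)%N => n kmn.
have := e (n - k)%N; rewrite !iter_tlE subnKC; last by apply: leq_trans kmn; apply: leq_addr.
by apply; rewrite leq_subRL // (leq_trans _ kmn) ?leq_addr.
Qed.

Lemma nonstationary_step (x : word) K : ~ stationary x ->
  exists2 k, (K <= k)%N & x k != x k.+1.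
Proof.
move=> sx; apply: contrapT => h; apply: sx; exists K => n Kn.
rewrite -(subnKC Kn); elim: (n - K)%N => [|j IH]; first by rewrite addn0.
rewrite addnS -IH; apply/esym; have [//|ne] := eqVneq (x (K + j)%N) (x (K + j).+1).
by exfalso; apply: h; exists (K + j)%N; rewrite ?leq_addr.
Qed.

(** The levels k are those where the word of x changes its letter. The blocks around x exhaust its
    component, so the representing points can be kept out of any finite set. *)
Lemma local_rep (R : realType) (z : R[i]) (x : word) K :
  julia R z -> ~ Sigma5 R z -> ~ stationary x ->
  exists2 k, (K <= k)%N &
    rep (z - 4) (fun y => iter k tl y <> iter k tl x /\ tail_eq y x) 16
      (fun f => f x).
Proof.
move=> Jz z5 sx; have [k Kk xk] := nonstationary_step K sx.
exists k => //; have [w sw xw] := place_iter_tl k x.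
have ex : iter k tl x = scons (x k) (scons (x k.+1) (iter k.+2 tl x)).
  apply/funext => -[|[|n]]; rewrite !iter_tlE /= ?addn0 ?addn1 //.
  by rewrite -!iterS iter_tlE !addnS.
have g j : (j < size w)%N -> iter j dec (z - 4) ^+ 2 != 1.
  by move=> _; have [] := orbit_good j Jz z5.
have [_ b1] := orbit_good (size w) Jz z5.
have [s [sQ sM sn]] := rep_off_block g (iter k.+2 tl x) xk b1.
exists s; split=> //.
  move=> t /sQ; rewrite /off_block sw -ex => -[h1 h2]; split=> //.
  exact: tail_eq_iterI h2.
by apply: null_ext sn => f; rewrite -ex -xw.
Qed.

(** * Power sums *)

Section PowerSums.
Variables (R : realType) (p : R).
Local Notation C := (R[i]).
Hypothesis p_gt0 : 0 < p.

(** Bounds the p-th power of the l^p norm by way of finite partial sums. *)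
Definition psum (X : eqType) (f : X -> C) (B : R) : Prop :=
  forall s : seq X, uniq s -> \sum_(x <- s) normc (f x) `^ p <= B.

Lemma powR_mono (x y : R) : 0 <= x -> x <= y -> x `^ p <= y `^ p.
Proof.
move=> x0 xy; apply: ge0_ler_powR => //; rewrite ?nnegrE //; first exact: ltW.
exact: le_trans xy.
Qed.

Lemma ler_sum_subseq (X : eqType) (s s' : seq X) (F : X -> R) :
  (forall x, 0 <= F x) -> uniq s -> uniq s' -> {subset s <= s'} ->
  \sum_(x <- s) F x <= \sum_(x <- s') F x.
Proof.
move=> F0 us us' ss'; rewrite [leRHS](bigID (mem s)) /=.
rewrite (perm_big [seq x <- s' | x \in s]) /=; last first.
  apply: uniq_perm; rewrite ?filter_uniq // => x; rewrite mem_filter.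
  by case: (boolP (x \in s)) => // /ss' ->.
by rewrite big_filter lerDl sumr_ge0.
Qed.

Lemma lp_psum (X : choiceType) (f : X -> C) : lp p f <-> exists B, psum f B.
Proof.
rewrite /lp /lp_norm /=; set S := esum _ _.
have S0 : (0 <= S)%E by apply: esum_ge0 => x _; rewrite lee_fin powR_ge0.
split=> [h|[B hB]].
  have {h} Slt : (S < +oo)%E by apply: lty_poweRy h; rewrite invr_eq0 gt_eqF.
  exists (fine S) => s us; rewrite -lee_fin fineK ?ge0_fin_numE //.
  apply: esum_ge; exists [set` s].
    by split=> //; exact: finite_seq.
  by rewrite -fsbig_seq // sumEFin.
apply: poweR_lty; apply: le_lt_trans (ltry B).
apply: ge_ereal_sup => _ [A [finA _] <-].
by rewrite fsbig_finite //= sumEFin lee_fin hB // finmap.fset_uniq.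
Qed.

Lemma psum_lp_norm (X : choiceType) (f : X -> C) B e : 0 < e ->
  psum f B -> B < e `^ p -> (lp_norm p f < e%:E)%E.
Proof.
move=> e0 hB Be; rewrite /lp_norm; set S := esum _ _.
have S0 : (0 <= S)%E by apply: esum_ge0 => x _; rewrite lee_fin powR_ge0.
have SB : (S <= B%:E)%E.
  apply: ge_ereal_sup => _ [A [finA _] <-].
  by rewrite fsbig_finite //= sumEFin lee_fin hB // finmap.fset_uniq.
have B0 : 0 <= B by rewrite -lee_fin (le_trans S0).
have Sfin : S \is a fin_num by rewrite ge0_fin_numE // (le_lt_trans SB) ?ltry.
rewrite -(fineK Sfin) poweR_EFin lte_fin.
have fS : 0 <= fine S by rewrite fine_ge0.
have fSB : fine S <= B by rewrite -lee_fin fineK.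
rewrite ltNge; apply/negP => h.
have : e `^ p <= (fine S `^ p^-1) `^ p.
  by apply: ge0_ler_powR; rewrite ?nnegrE ?powR_ge0 // ltW.
rewrite -powRrM mulVf ?gt_eqF // powRr1 //; lra.
Qed.

Section Basic.
Variable X : eqType.
Implicit Types f g : X -> C.

Lemma psum_ge0 f B : psum f B -> 0 <= B.
Proof. by move=> /(_ [::] isT); rewrite big_nil. Qed.

Lemma psum_le f B B' : B <= B' -> psum f B -> psum f B'.
Proof. by move=> BB' h s us; apply: le_trans (h s us) BB'. Qed.

Lemma psum_mono f g B : (forall x, normc (f x) <= normc (g x)) ->
  psum g B -> psum f B.
Proof.
move=> fg h s us; apply: le_trans (h s us); apply: ler_sum => x _.
by apply: powR_mono; rewrite ?normc_ge0.
Qed.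

Lemma psum_ext f g B : f =1 g -> psum f B -> psum g B.
Proof. by move=> fg; apply: psum_mono => x; rewrite fg. Qed.

Lemma psum0 : psum (fun _ : X => 0) 0.
Proof.
by move=> s _; rewrite big1 // => x _; rewrite normc0 powR0 ?gt_eqF.
Qed.

Lemma psumZ c f B : psum f B -> psum (fun x => c * f x) (normc c `^ p * B).
Proof.
move=> h s us; under eq_bigr do rewrite normcM powRM ?normc_ge0 //.
by rewrite -mulr_sumr ler_wpM2l ?powR_ge0 ?h.
Qed.

Lemma powR_add_le (x y : R) : 0 <= x -> 0 <= y ->
  (x + y) `^ p <= 2 `^ p * (x `^ p + y `^ p).
Proof.
wlog xy : x y / x <= y => [wl x0 y0|x0 y0].
  by case: (leP x y) => [/wl|/ltW /wl h]; [apply|rewrite addrC (addrC (x `^ p)) h].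
apply: (@le_trans _ _ ((2 * y) `^ p)).
  by apply: powR_mono; lra.
by rewrite powRM // ler_wpM2l ?powR_ge0 // lerDr powR_ge0.
Qed.

Lemma psumD f g B B' : psum f B -> psum g B' ->
  psum (fun x => f x + g x) (2 `^ p * (B + B')).
Proof.
move=> hf hg s us.
apply: (@le_trans _ _ (\sum_(x <- s)
   2 `^ p * (normc (f x) `^ p + normc (g x) `^ p))).
  apply: ler_sum => x _; apply: le_trans (powR_add_le (normc_ge0 _) (normc_ge0 _)).
  by apply: powR_mono; [apply: normc_ge0|apply: le_normcD].
rewrite -mulr_sumr ler_wpM2l ?powR_ge0 // big_split /= lerD //.
  exact: hf.
exact: hg.
Qed.

Lemma psumN f B : psum f B -> psum (fun x => - f x) B.
Proof. by apply: psum_mono => x; rewrite normcN. Qed.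

Lemma psum_pt f B x : psum f B -> normc (f x) `^ p <= B.
Proof. by move=> /(_ [:: x] isT); rewrite big_seq1. Qed.

Lemma psum_bounded f B : psum f B -> exists2 H, 0 <= H & forall x, normc (f x) <= H.
Proof.
move=> h; have B0 := psum_ge0 h; exists (B `^ p^-1); first exact: powR_ge0.
move=> x; rewrite leNgt; apply/negP => lt.
have := psum_pt x h; rewrite leNgt => /negP; apply.
have p0 : p != 0 by rewrite gt_eqF.
rewrite -[ltLHS](powRr1 B0) -(mulVf p0) powRrM.
by apply: gt0_ltr_powR; rewrite ?nnegrE ?powR_ge0 ?normc_ge0.
Qed.

Lemma psum_decay f B e : 0 < e -> psum f B ->
  exists K : seq X, forall x, x \notin K -> normc (f x) <= e.
Proof.
move=> e0 h; apply: contrapT => ne.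
have many n : exists s : seq X, [/\ uniq s, size s = n &
    forall x, x \in s -> e <= normc (f x)].
  elim: n => [|n [s [us ss hs]]]; first by exists [::].
  apply: contrapT => nx; apply: ne; exists s => x xs.
  rewrite leNgt; apply/negP => lt; apply: nx; exists (x :: s).
  split=> /=; rewrite ?xs ?ss // => y; rewrite inE => /predU1P[->|/hs//].
  exact: ltW.
have [n hn] := nat_above (B / e `^ p).
have [s [us ss hs]] := many n.
have := h s us; rewrite leNgt => /negP; apply.
have ep : 0 < e `^ p by apply: powR_gt0.
apply: lt_le_trans (_ : n%:R * e `^ p <= _); first by rewrite -ltr_pdivrMr.
have -> : n%:R * e `^ p = \sum_(x <- s) e `^ p.
  by rewrite big_const_seq count_predT iter_addr_0 ss mulr_natl.
rewrite big_seq [leRHS]big_seq; apply: ler_sum => x xs.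
by apply: powR_mono; [apply: ltW|apply: hs].
Qed.

Lemma psum_tail f B e : 0 < e -> psum f B ->
  exists2 K : seq X, uniq K & psum (fun x => if x \in K then 0 else f x) e.
Proof.
move=> e0 h.
pose A := [set r : R | exists2 s, uniq s & r = \sum_(x <- s) normc (f x) `^ p].
have A0 : A !=set0 by exists 0; exists [::] => //; rewrite big_nil.
have Aub : has_ubound A by exists B => _ [s us ->]; apply: h.
have [_ [K uK ->] hK] := sup_adherent e0 (conj A0 Aub).
exists K => // s us.
have -> : \sum_(x <- s) normc (if x \in K then 0 else f x) `^ p =
    \sum_(x <- [seq x <- s | x \notin K]) normc (f x) `^ p.
  rewrite big_filter [RHS]big_mkcond /=; apply: eq_bigr => x _.
  by case: ifP => // _; rewrite normc0 powR0 // gt_eqF.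
have : A (\sum_(x <- K ++ [seq x <- s | x \notin K]) normc (f x) `^ p).
  exists (K ++ [seq x <- s | x \notin K]) => //.
  rewrite cat_uniq uK filter_uniq // andbT /=.
  by apply/hasPn => x; rewrite mem_filter => /andP[].
move/(ub_le_sup Aub); rewrite big_cat /= => hs.
by move: hK hs; lra.
Qed.

End Basic.

(** The tag k separates the points of each fibre of h, so h is at most n-to-one. *)
Lemma psum_comp (X Y : eqType) n (h : X -> Y) (k : X -> 'I_n) (f : Y -> C) B :
  injective (fun x => (h x, k x)) -> psum f B ->
  psum (fun x => f (h x)) (B *+ n).
Proof.
move=> hk hB s us.
apply: (@le_trans _ _ (\sum_(i < n) \sum_(x <- s | k x == i) normc (f (h x)) `^ p)).
  rewrite (exchange_big_dep predT) //=; apply: ler_sum => x _.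
  by rewrite (big_pred1 (k x)) // => i; rewrite eq_sym.
rewrite -[n in leRHS]card_ord -sumr_const; apply: ler_sum => i _.
rewrite -big_filter -(big_map h predT (fun y => normc (f y) `^ p)).
apply: hB; rewrite map_inj_in_uniq ?filter_uniq // => x y.
rewrite !mem_filter => /andP[/eqP kx _] /andP[/eqP ky _] hxy.
by apply: hk; rewrite hxy kx ky.
Qed.

Lemma psum_comp_inj (X Y : eqType) (h : X -> Y) (f : Y -> C) B :
  injective h -> psum f B -> psum (fun x => f (h x)) B.
Proof.
move=> hI hB s us; rewrite -(big_map h predT (fun y => normc (f y) `^ p)).
by apply: hB; rewrite map_inj_uniq.
Qed.

Lemma psum_finite (X : eqType) (f : X -> C) (K : seq X) :
  (forall x, x \notin K -> f x = 0) -> exists B, psum f B.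
Proof.
move=> f0; exists (\sum_(x <- undup K) normc (f x) `^ p) => s us.
rewrite (bigID (mem K)) /= [X in _ + X]big1 ?addr0; last first.
  by move=> x xK; rewrite f0 // normc0 powR0 // gt_eqF.
rewrite -big_filter; apply: ler_sum_subseq; rewrite ?undup_uniq ?filter_uniq //.
  by move=> x; apply: powR_ge0.
by move=> x; rewrite mem_filter mem_undup => /andP[].
Qed.

End PowerSums.

(** * Kernel and density of the range on the Julia set *)

Section WordSpectrum.
Variables (R : realType) (p : R).
Local Notation C := (R[i]).
Hypothesis p_gt1 : 1 < p.

Let p_gt0 : 0 < p. Proof. exact: lt_trans p_gt1. Qed.

Definition summ (X : eqType) (f : X -> C) : Prop := exists B, psum p f B.

Lemma summ_ext (X : eqType) (f g : X -> C) : f =1 g -> summ f -> summ g.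
Proof. by move=> fg [B h]; exists B; apply: psum_ext h. Qed.

Lemma summ0 (X : eqType) : summ (fun _ : X => 0).
Proof. by exists 0; apply: psum0. Qed.

Lemma summD (X : eqType) (f g : X -> C) :
  summ f -> summ g -> summ (fun x => f x + g x).
Proof. by move=> [B h] [B' h']; exists (2 `^ p * (B + B')); apply: psumD. Qed.

Lemma summZ (X : eqType) c (f : X -> C) : summ f -> summ (fun x => c * f x).
Proof. by move=> [B h]; exists (normc c `^ p * B); apply: psumZ. Qed.

Lemma summB (X : eqType) (f g : X -> C) :
  summ f -> summ g -> summ (fun x => f x - g x).
Proof.
move=> hf hg; apply: summ_ext (summD hf (summZ (-1) hg)) => x.
by rewrite mulN1r.
Qed.

Lemma summ_sum (X : eqType) (I : Type) (r : seq I) (f : I -> X -> C) :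
  (forall i, summ (f i)) -> summ (fun x => \sum_(i <- r) f i x).
Proof.
move=> h; elim: r => [|i r IH].
  by apply: summ_ext (@summ0 X) => x; rewrite big_nil.
by apply: summ_ext (summD (h i) IH) => x; rewrite big_cons.
Qed.

Lemma summ_comp (X Y : eqType) n (h : X -> Y) (k : X -> 'I_n) (f : Y -> C) :
  injective (fun x => (h x, k x)) -> summ f -> summ (fun x => f (h x)).
Proof. by move=> hk [B hB]; exists (B *+ n); apply: psum_comp hk hB. Qed.

Lemma psum_flip (f : word -> C) B : psum p f B -> psum p (fun x => f (flip x)) B.
Proof. by apply: psum_comp_inj; apply: inv_inj flipK. Qed.

Lemma summ_flip (f : word -> C) : summ f -> summ (fun x => f (flip x)).
Proof. by move=> [B h]; exists B; apply: psum_flip. Qed.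

Lemma tl_hd_inj : injective (fun x : word => (tl x, x 0)).
Proof. by move=> x y [e1 e2]; rewrite -(scons_tl x) -(scons_tl y) e1 e2. Qed.

Lemma summ_tl (f : word -> C) : summ f -> summ (fun x => f (tl x)).
Proof. exact: summ_comp tl_hd_inj. Qed.

Lemma summ_fsum (f : word -> C) : summ f -> summ (fsum f).
Proof.
move=> [B h]; apply: summ_sum => c; exists B.
by apply: psum_comp_inj h => x y /scons_inj[].
Qed.

Lemma cellop_ext a (f g : word -> C) : f =1 g -> cellop a f =1 cellop a g.
Proof. by move=> /funext ->. Qed.

Lemma cellopD a (f g : word -> C) x :
  cellop a (fun y => f y + g y) x = cellop a f x + cellop a g x.
Proof. by rewrite /cellop /fsum big_split /=; ring. Qed.

Lemma cellopZ a c (f : word -> C) x :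
  cellop a (fun y => c * f y) x = c * cellop a f x.
Proof. by rewrite /cellop /fsum -mulr_sumr; ring. Qed.

Lemma cellopB a (f g : word -> C) x :
  cellop a (fun y => f y - g y) x = cellop a f x - cellop a g x.
Proof. by rewrite /cellop /fsum sumrB; ring. Qed.

Lemma cellop0 a x : cellop a (fun=> 0 : C) x = 0.
Proof. by rewrite /cellop /fsum big1 // mulr0 !addr0. Qed.

Lemma cellop_sum a (I : Type) (r : seq I) (f : I -> word -> C) x :
  cellop a (fun y => \sum_(i <- r) f i y) x = \sum_(i <- r) cellop a (f i) x.
Proof.
elim: r => [|i r IH].
  rewrite big_nil (@cellop_ext _ _ (fun=> 0)) ?cellop0 // => y.
  by rewrite big_nil.
rewrite big_cons -IH -cellopD; apply: cellop_ext => y.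
by rewrite big_cons.
Qed.

Lemma normc_sum (I : Type) (r : seq I) (F : I -> C) :
  normc (\sum_(i <- r) F i) <= \sum_(i <- r) normc (F i).
Proof.
elim: r => [|i r IH]; first by rewrite !big_nil normc0.
rewrite !big_cons; apply: le_trans (le_normcD _ _) _.
by rewrite lerD2l.
Qed.

Lemma tail_eq_uniform (K : seq word) x :
  exists k0, forall y, y \in K -> tail_eq y x -> forall k, (k0 <= k)%N ->
    iter k tl y = iter k tl x.
Proof.
elim: K => [|y K [k0 IH]]; first by exists 0%N.
have [/tail_eq_iter[k1 h1]|nyx] := pselect (tail_eq y x); last first.
  exists k0 => u; rewrite inE => /predU1P[-> //|uK]; exact: IH.
exists (maxn k0 k1) => u; rewrite inE => hu uT k.
rewrite geq_max => /andP[h0 h1k]; case/predU1P: hu => [->|uK]; first exact: h1.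
exact: IH.
Qed.

Section Julia.
Variable z : C.
Hypotheses (Jz : julia R z) (z5 : ~ Sigma5 R z).

(** By [local_rep], f x is a combination of mass 16 of values outside any finite set. Taking the set
    where |f| may exceed |f x| / 32 gives |f x| <= |f x| / 2. *)
Lemma kernel_vanish (f : word -> C) x : ~ stationary x ->
  (forall e : R, 0 < e -> exists K : seq word,
     forall y, y \notin K -> normc (f y) <= e) ->
  (forall y, cellop (z - 4) f y = 0) -> f x = 0.
Proof.
move=> sx f0 Af; apply: eq0_normc; apply/eqP; rewrite eq_le normc_ge0 andbT.
rewrite leNgt; apply/negP => d0.
have [K hK] := f0 (normc (f x) / 32) ltac:(by rewrite divr_gt0).
have [k0 hk0] := tail_eq_uniform K x.
have [k k0k [s [sQ sM [e he]]]] := local_rep k0 Jz z5 sx.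
have : f x - \sum_(t <- s) t.1 * f t.2 = 0.
  by rewrite he big1 // => t _; rewrite Af mulr0.
move=> /eqP; rewrite subr_eq0 => /eqP fx.
have : normc (f x) <= \sum_(t <- s) normc t.1 * (normc (f x) / 32).
  rewrite {1}fx; apply: le_trans (normc_sum _ _) _.
  rewrite big_seq [leRHS]big_seq; apply: ler_sum => t /sQ[ne te].
  rewrite normcM ler_wpM2l ?normc_ge0 // hK //; apply/negP => tK.
  exact/ne/hk0.
rewrite -mulr_suml => h.
have : (\sum_(t <- s) normc t.1) * (normc (f x) / 32) <= 16 * (normc (f x) / 32).
  by rewrite ler_wpM2r // ltW // divr_gt0.
by move: h d0; lra.
Qed.

(** * Point masses and density of the range *)

Definition pt (x : word) : word -> C := fun y => (y == x)%:R.

Definition comb (s : seq (C * word)) : word -> C :=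
  fun y => \sum_(t <- s) t.1 * pt t.2 y.

Lemma pt_sym x y : pt x y = pt y x. Proof. by rewrite /pt eq_sym. Qed.

(** Symmetry turns relations modulo [null] into statements about the range: a null functional
    evaluated at all point masses is the image of a finitely supported function. *)
Lemma cellop_pt_sym a x y : cellop a (pt x) y = cellop a (pt y) x.
Proof.
rewrite /cellop pt_sym; congr (_ + _ + _).
  by rewrite /pt -(inj_eq (inv_inj flipK)) flipK eq_sym.
have h u v : fsum (pt u) (tl v) = (tl u == tl v)%:R.
  rewrite /fsum (bigD1 (u 0)) //= big1 ?addr0 => [|c cu]; rewrite /pt.
    rewrite -{2}(scons_tl u); congr (_%:R); congr nat_of_bool.
    apply/eqP/eqP => [/scons_inj[_ ->]//|->//].
  case: eqP => // e; move: cu; rewrite -{1}(scons_tl u) in e.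
  by case/scons_inj: e => ->; rewrite eqxx.
by rewrite !h eq_sym.
Qed.

Lemma comb_notin s y : y \notin [seq t.2 | t <- s] -> comb s y = 0.
Proof.
move=> ys; rewrite /comb big_seq big1 // => t ts; rewrite /pt.
case: eqP => [e|]; last by rewrite mulr0.
by move: ys; rewrite e map_f.
Qed.

Lemma comb_le s y : normc (comb s y) <= \sum_(t <- s) normc t.1.
Proof.
apply: le_trans (normc_sum _ _) _; apply: ler_sum => t _.
rewrite /pt; case: (y == t.2); rewrite ?mulr1 ?mulr0 ?normc0 ?normc_ge0 //.
Qed.

Lemma comb_sum s (v : seq word) : uniq v ->
  \sum_(y <- v) normc (comb s y) <= \sum_(t <- s) normc t.1.
Proof.
move=> uv.
apply: (@le_trans _ _ (\sum_(y <- v) \sum_(t <- s) normc t.1 * (y == t.2)%:R)).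
  apply: ler_sum => y _; apply: le_trans (normc_sum _ _) _.
  apply: ler_sum => t _; rewrite /pt.
  by case: (y == t.2); rewrite ?mulr1 ?mulr0 ?normc0.
rewrite exchange_big; apply: ler_sum => t _; rewrite -mulr_sumr.
rewrite ler_piMr ?normc_ge0 //.
have [tv|tv] := boolP (t.2 \in v).
  rewrite (bigD1_seq _ tv) //= eqxx big1 ?addr0 // => y.
  by move=> /negbTE ->.
rewrite big_seq big1 // => y yv; case: eqP => // e.
by rewrite e (negbTE tv) in yv.
Qed.

(** Representations of f x at sufficiently different levels have disjoint supports. Adding J of them
    multiplies the mass by J but keeps each single coefficient at most 16. *)
Lemma average_rep x J : ~ stationary x -> exists s : seq (C * word),
  [/\ forall t, t \in s -> tail_eq t.2 x,
      \sum_(t <- s) normc t.1 <= 16 * J%:R,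
      forall y, normc (comb s y) <= 16 &
      null (z - 4) (fun f => J%:R * f x - \sum_(t <- s) t.1 * f t.2)].
Proof.
move=> sx; elim: J => [|J [s [sT s1 sm sn]]].
  exists [::]; split=> //; first by rewrite big_nil mulr0.
    by move=> y; rewrite /comb big_nil normc0.
  by apply: null_ext (null0 _) => f; rewrite big_nil mul0r subr0.
have [k0 hk0] := tail_eq_uniform [seq t.2 | t <- s] x.
have [k k0k [s' [sQ' sM' sn']]] := local_rep k0 Jz z5 sx.
exists (s ++ s'); split.
- by move=> t; rewrite mem_cat => /orP[/sT|/sQ'[]].
- by rewrite big_cat /= -natr1; lra.
- move=> y; rewrite /comb big_cat /= -!/(comb _ _).
  have [ys|/comb_notin ->] := boolP (y \in [seq t.2 | t <- s]); last first.
    by rewrite add0r; apply: le_trans (comb_le _ _) sM'.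
  rewrite (@comb_notin s') ?addr0 //; apply/negP => /mapP[t /sQ'[ne te] yt].
  by apply: ne; apply: hk0 => //; rewrite -yt.
- apply: null_ext (nullD sn sn') => f; rewrite big_cat /= -natr1.
  by ring.
Qed.

(** Divided by J, the combination has mass at most 16 and entries at most 16 / J, so its p-th power
    sum is at most 16 (16 / J)^(p - 1). *)
Lemma approx_pt x e : 0 < e -> ~ stationary x ->
  exists2 g, summ g & psum p (fun y => cellop (z - 4) g y - pt x y) e.
Proof.
move=> e0 sx.
have q0 : 0 < p - 1 by rewrite subr_gt0.
(* With entries at most d, the bound 16 d^(p - 1) equals e. *)
pose d := (e / 16) `^ (p - 1)^-1.
have d0 : 0 < d by rewrite powR_gt0 // divr_gt0.
have [J hJ] := nat_above (16 / d).
have J0 : 0 < J%:R :> R by apply: lt_trans hJ; rewrite divr_gt0.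
have JC : (J%:R : C) != 0 by rewrite pnatr_eq0 -lt0n -(ltr0n R).
have normJ : normc (J%:R^-1 : C) = J%:R^-1.
  by rewrite normcV; have := normcMn (1 : C) J; rewrite normc1 => ->.
have [s [sT s1 sm [u hu]]] := average_rep J sx.
pose g y := J%:R^-1 * comb u y.
exists g.
  have [B hB] := @psum_finite R p p_gt0 _ (comb u) _ (@comb_notin u).
  by apply: summZ; exists B.
apply: (@psum_ext _ _ p_gt0 _ (fun y => (- J%:R^-1) * comb s y)).
  move=> y; rewrite /g cellopZ /comb cellop_sum.
  rewrite [in RHS](eq_bigr (fun t => t.1 * cellop (z - 4) (pt y) t.2)); last first.
    by move=> t _; rewrite cellopZ cellop_pt_sym.
  rewrite -hu pt_sym (pt_sym x).
  under eq_bigr do rewrite pt_sym.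
  by field.
move=> v uv.
apply: (@le_trans _ _ (\sum_(y <- v) J%:R^-1 * normc (comb s y) * (e / 16))).
  apply: ler_sum => y _; rewrite normcM normcN normJ.
  set n := _ * _; have n0 : 0 <= n by rewrite mulr_ge0 ?invr_ge0 ?normc_ge0 // ltW.
  rewrite -mulr_powRB1 //; apply: ler_wpM2l => //.
  have -> : e / 16 = d `^ (p - 1).
    by rewrite /d -powRrM mulVf ?gt_eqF // powRr1 // divr_ge0 // ltW.
  apply: powR_mono => //.
  apply: le_trans (_ : J%:R^-1 * 16 <= _).
    by rewrite ler_wpM2l ?invr_ge0 ?(ltW J0).
  by rewrite mulrC ler_pdivrMr // mulrC -ler_pdivrMr // ltW.
rewrite -mulr_suml -mulr_sumr.
have h : \sum_(y <- v) normc (comb s y) <= 16 * J%:R.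
  exact: le_trans (comb_sum _ uv) s1.
apply: le_trans (_ : J%:R^-1 * (16 * J%:R) * (e / 16) <= _).
  by rewrite ler_wpM2r ?ler_wpM2l ?invr_ge0 ?(ltW J0) // divr_ge0 // ltW.
by rewrite mulrC le_eqVlt; apply/orP; left; apply/eqP; field; rewrite gt_eqF.
Qed.

(** h is cut down to a finite set and then approximated one point mass at a time; the factors 2 *
    2^p compensate the constant of [psumD]. *)
Lemma approx_words (h : word -> C) e : 0 < e -> summ h ->
  (forall y, h y != 0 -> ~ stationary y) ->
  exists2 g, summ g & psum p (fun y => cellop (z - 4) g y - h y) e.
Proof.
move=> e0 [B hB] hs.
have c0 : 0 < 2 `^ p :> R by apply: powR_gt0.
have fin (K : seq word) : forall e : R, 0 < e -> exists2 g, summ g &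
    psum p (fun y => cellop (z - 4) g y - \sum_(x <- K) h x * pt x y) e.
  elim: K => [|x K IH] d d0.
    exists (fun=> 0); first exact: summ0.
    apply: psum_le (ltW d0) _; apply: (psum_ext p_gt0 _ (@psum0 _ _ p_gt0 _)) => y.
    by rewrite cellop0 big_nil subrr.
  have d2 : 0 < d / (2 * 2 `^ p) by rewrite divr_gt0 // mulr_gt0.
  have [g2 sg2 hg2] := IH _ d2.
  have [g1 sg1 hg1] : exists2 g, summ g & psum p (fun y =>
      cellop (z - 4) g y - h x * pt x y) (d / (2 * 2 `^ p)).
    have [hx|hx] := eqVneq (h x) 0.
      exists (fun=> 0); first exact: summ0.
      apply: psum_le (ltW d2) _; apply: (psum_ext p_gt0 _ (@psum0 _ _ p_gt0 _)) => y.
      by rewrite cellop0 hx mul0r subrr.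
    have nx : 0 < normc (h x) `^ p.
      apply: powR_gt0; rewrite lt_neqAle normc_ge0 andbT eq_sym.
      by apply: contra hx => /eqP /eq0_normc ->.
    have [g sg hg] := approx_pt (divr_gt0 d2 nx) (hs _ hx).
    exists (fun y => h x * g y); first exact: summZ.
    have := psumZ (h x) hg.
    rewrite mulrC divfK ?gt_eqF //; apply: psum_ext => // y.
    by rewrite cellopZ mulrBr.
  exists (fun y => g1 y + g2 y); first exact: summD.
  have := psumD p_gt0 hg1 hg2.
  have -> : 2 `^ p * (d / (2 * 2 `^ p) + d / (2 * 2 `^ p)) = d.
    by field; rewrite gt_eqF.
  apply: psum_ext => // y; rewrite cellopD big_cons; ring.
have d2 : 0 < e / (2 * 2 `^ p) by rewrite divr_gt0 // mulr_gt0.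
have [K uK hK] := psum_tail p_gt0 d2 hB.
have [g sg hg] := fin K _ d2.
exists g => //.
have := psumD p_gt0 hg (psumN p_gt0 hK).
have -> : 2 `^ p * (e / (2 * 2 `^ p) + e / (2 * 2 `^ p)) = e.
  by field; rewrite gt_eqF.
apply: psum_ext => // y; rewrite -addrA; congr (_ + _); rewrite -opprD.
congr (- _); case: ifPn => yK.
  rewrite addr0 (bigD1_seq y) //= big1 ?addr0 => [|x xy]; rewrite /pt.
    by rewrite eqxx mulr1.
  by rewrite eq_sym (negbTE xy) mulr0.
rewrite big_seq big1 ?add0r // => x xK; rewrite /pt.
case: eqP => [yx|]; last by rewrite mulr0.
by rewrite yx xK in yK.
Qed.

End Julia.
End WordSpectrum.

(** * Invertibility off the Julia set *)

Section Resolvent.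
Variables (R : realType) (p : R).
Local Notation C := (R[i]).
Hypothesis p_gt1 : 1 < p.

Let p_gt0 : 0 < p. Proof. exact: lt_trans p_gt1. Qed.

Definition cell_inj a := forall u : word -> C, summ p u ->
  (forall x, cellop a u x = 0) -> forall x, u x = 0.

Definition cell_surj a := forall h : word -> C, summ p h ->
  exists2 u, summ p u & forall x, cellop a u x = h x.

Lemma cell_inj_step a : a ^+ 2 != 1 -> cell_inj (dec a) -> cell_inj a.
Proof.
move=> a1 inj u su u0.
have S0 z : fsum u z = 0.
  apply: inj (summ_fsum p_gt1 su) _ z => z.
  by rewrite cellop_fsum big1 ?oppr0 // => c _; rewrite !u0 mulr0 subr0.
move=> x; have := cellop_solve a u x; rewrite !u0 !S0 !mulr0 !subr0 addr0.
by move=> /esym/eqP; rewrite mulf_eq0 subr_eq0 (negbTE a1) => /eqP.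
Qed.

(** The triple sums w of a solution satisfy the coarser equation with right side - S (a - P) h.
    Given w, the equation (a + P) u = h - w o tl is solved by (a - P) / (a^2 - 1). *)
Lemma cell_surj_step a : a ^+ 2 != 1 -> cell_surj (dec a) -> cell_surj a.
Proof.
move=> a1 surj h sh.
have a10 : a ^+ 2 - 1 != 0 by rewrite subr_eq0.
pose k x := a * h x - h (flip x).
have sk : summ p k by apply: summB => //; [apply: summZ|apply: summ_flip].
have [w sw hw] := surj _ (summZ (-1) (summ_fsum p_gt1 sk)).
pose m x := h x - w (tl x).
have sm : summ p m by apply: summB => //; apply: summ_tl.
exists (fun x => (a ^+ 2 - 1)^-1 * (a * m x - m (flip x))).
  by apply: summZ; apply: summB => //; [apply: summZ|apply: summ_flip].
move=> x; rewrite /cellop flipK /fsum -mulr_sumr.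
have -> : \sum_c (a * m (scons c (tl x)) - m (flip (scons c (tl x)))) =
    fsum k (tl x) - 3 * a * w (tl x) + \sum_c w (nb (tl x) c).
  rewrite /m /k /fsum.
  under eq_bigr do rewrite tl_flip_scons tl_scons.
  rewrite !sumrB -mulr_sumr !sumrB sumr_const card_ord -mulr_sumr -mulr_natr.
  by ring.
have := hw (tl x); rewrite cellop_nb mulN1r => /eqP.
rewrite -subr_eq0 => /eqP hs.
have -> : \sum_d w (nb (tl x) d) = - fsum k (tl x) - (dec a + 1) * w (tl x).
  apply/eqP; rewrite -subr_eq0; apply/eqP; rewrite -[RHS]hs; ring.
rewrite /dec /m; field => //.
Qed.

Lemma le_normcB (u v : C) : normc (u - v) <= normc u + normc v.
Proof. by rewrite -(normcN v); apply: le_normcD. Qed.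

Definition offdiag (f : word -> C) x := f (flip x) + fsum f (tl x).

Lemma offdiag_bound (f : word -> C) H : (forall x, normc (f x) <= H) ->
  forall x, normc (offdiag f x) <= 4 * H.
Proof.
move=> fH x; apply: le_trans (le_normcD _ _) _.
have : normc (fsum f (tl x)) <= 3 * H.
  apply: le_trans (normc_sum _ _) _.
  apply: le_trans (_ : \sum_(c < 3) H <= _); first exact: ler_sum.
  by rewrite sumr_const card_ord mulr_natl.
by have := fH (flip x); lra.
Qed.

Lemma geometric_small (H e : R) : 0 <= H -> 0 < e ->
  exists n : nat, H / 2 ^+ n <= e.
Proof.
move=> H0 e0; have [n hn] := nat_above (H / e); exists n.
rewrite ler_pdivrMr ?exprn_gt0 // mulrC -ler_pdivrMr //.
apply: le_trans (ltW hn) _; rewrite -natrX ler_nat.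
by apply: ltnW; apply: ltn_expl.
Qed.

(** The off-diagonal part at most quadruples the supremum norm, so |a| >= 8 lets any bound on u be
    halved. *)
Lemma cell_inj_large a : 8 <= normc a -> cell_inj a.
Proof.
move=> a8 u [B hB] u0 x.
have [H H0 hH] := psum_bounded p_gt0 hB.
have h n : forall y, normc (u y) <= H / 2 ^+ n.
  elim: n => [|n IH] y; first by rewrite expr0 divr1.
  have := offdiag_bound IH y; set K := H / 2 ^+ n => hK.
  have /eqP := u0 y; rewrite /cellop -addrA -/(offdiag u y) addr_eq0.
  move=> /eqP /(congr1 (@normc R)); rewrite normcN normcM => e.
  have -> : H / 2 ^+ n.+1 = K / 2 by rewrite /K exprS; field; rewrite expf_neq0.
  have := normc_ge0 (u y); move: hK; rewrite -e; nra.
apply: eq0_normc; apply/eqP; rewrite eq_le normc_ge0 andbT leNgt; apply/negP => d0.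
have [n hn] := geometric_small H0 (divr_gt0 d0 (ltr0n R 2)).
by have := h n x; lra.
Qed.

(** The intervals of radius 2 H / 2^n around v n are nested; the supremum of their left ends lies in
    all of them. *)
Lemma nested_limit (v : nat -> R) H :
  (forall n, `|v n.+1 - v n| <= H / 2 ^+ n) ->
  exists l, forall n, `|v n - l| <= 2 * H / 2 ^+ n.
Proof.
move=> hv.
have step n : v n - 2 * H / 2 ^+ n <= v n.+1 - 2 * H / 2 ^+ n.+1 /\
    v n.+1 + 2 * H / 2 ^+ n.+1 <= v n + 2 * H / 2 ^+ n.
  have := hv n; rewrite ler_norml => /andP[].
  rewrite exprS; set q := 2 ^+ n.
  have q0 : q != 0 by rewrite expf_neq0.
  have -> : 2 * H / (2 * q) = H / q by field.
  have -> : 2 * H / q = H / q + H / q by field.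
  by move=> *; split; lra.
pose A := [set v n - 2 * H / 2 ^+ n | n in [set: nat]].
have lo n k : v n - 2 * H / 2 ^+ n <= v (n + k)%N - 2 * H / 2 ^+ (n + k).
  elim: k => [|k IH]; first by rewrite addn0.
  by rewrite addnS; apply: le_trans IH (step _).1.
have hi n k : v (n + k)%N + 2 * H / 2 ^+ (n + k) <= v n + 2 * H / 2 ^+ n.
  elim: k => [|k IH]; first by rewrite addn0.
  by rewrite addnS; apply: le_trans (step _).2 IH.
have H0 : 0 <= H by have := hv 0%N; rewrite expr0 divr1; apply: le_trans.
have pos n : 0 <= 2 * H / 2 ^+ n by rewrite divr_ge0 ?exprn_ge0 // mulr_ge0.
have ub n m : v m - 2 * H / 2 ^+ m <= v n + 2 * H / 2 ^+ n.
  have := lo m n; have := hi n m; rewrite addnC.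
  have := pos (m + n)%N; lra.
have Aub : has_ubound A by exists (v 0%N + 2 * H / 2 ^+ 0) => _ [n _ <-].
have A0 : A !=set0 by exists (v 0%N - 2 * H / 2 ^+ 0), 0%N.
exists (sup A) => n.
have h1 : v n - 2 * H / 2 ^+ n <= sup A by apply: ub_le_sup => //; exists n.
have h2 : sup A <= v n + 2 * H / 2 ^+ n by apply: ge_sup => // _ [m _ <-].
by rewrite ler_norml; apply/andP; split; lra.
Qed.

Lemma abs_Re_le (w : C) : `|complex.Re w| <= normc w.
Proof.
case: w => r s /=; rewrite -sqrtr_sqr; apply: ler_wsqrtr.
by rewrite lerDl sqr_ge0.
Qed.

Lemma abs_Im_le (w : C) : `|complex.Im w| <= normc w.
Proof.
case: w => r s /=; rewrite -sqrtr_sqr; apply: ler_wsqrtr.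
by rewrite lerDr sqr_ge0.
Qed.

Lemma normc_le_ReIm (w : C) : normc w <= `|complex.Re w| + `|complex.Im w|.
Proof.
case: w => r s /=.
rewrite -[leRHS]ger0_norm ?addr_ge0 // -[leRHS]sqrtr_sqr; apply: ler_wsqrtr.
rewrite -(real_normK (num_real r)) -(real_normK (num_real s)).
have := normr_ge0 r; have := normr_ge0 s; nra.
Qed.

Lemma nested_limitC (v : nat -> C) H :
  (forall n, normc (v n.+1 - v n) <= H / 2 ^+ n) ->
  exists l, forall n, normc (v n - l) <= 4 * H / 2 ^+ n.
Proof.
move=> hv.
have [l1 h1] := @nested_limit (fun n => complex.Re (v n)) H (fun n =>
  le_trans (eq_ind _ (fun r => `|r| <= _) (abs_Re_le _) _ (raddfB _ _ _)) (hv n)).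
have [l2 h2] := @nested_limit (fun n => complex.Im (v n)) H (fun n =>
  le_trans (eq_ind _ (fun r => `|r| <= _) (abs_Im_le _) _ (raddfB _ _ _)) (hv n)).
exists (l1 +i* l2) => n; apply: le_trans (normc_le_ReIm _) _.
rewrite !raddfB /=; have := h1 n; have := h2 n.
have -> : 4 * H / 2 ^+ n = 2 * H / 2 ^+ n + 2 * H / 2 ^+ n.
  by field; rewrite expf_neq0.
lra.
Qed.

Lemma psum_offdiag (f : word -> C) B : psum p f B ->
  psum p (offdiag f) (10 * (2 `^ p) ^+ 3 * B).
Proof.
move=> hB; have B0 := psum_ge0 hB.
set c := 2 `^ p; have c1 : 1 <= c.
  by rewrite -(powRr0 2) ler_powR ?ler1n // ltW.
have hc (i : 'I_3) : psum p (fun x => f (scons i x)) B.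
  by apply: psum_comp_inj hB => x y /scons_inj[].
have h3 : psum p (fsum f) (c * (c * (B + B) + B)).
  have [d [e [d0 e0 ed]]] : exists d e : 'I_3, [/\ ord0 != d, e != ord0 & e != d].
    have d0 : ord0 != ord0 + 1 :> 'I_3 by [].
    by have [e [e0 ed _]] := third_letter d0; exists (ord0 + 1), e.
  apply: psum_ext (psumD p_gt0 (psumD p_gt0 (hc ord0) (hc d)) (hc e)) => // x.
  by rewrite /fsum (sum_letters _ d0 e0 ed).
have := psumD p_gt0 (psum_flip hB) (psum_comp tl_hd_inj h3).
apply: psum_le; rewrite -/c -mulr_natr.
have : 0 <= (c - 1) * c * B by rewrite !mulr_ge0 //; lra.
have : 0 <= (c ^+ 2 - 1) * c * B.
  by rewrite !mulr_ge0 //; [nra|lra].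
rewrite !exprS expr0 mulr1; nra.
Qed.

(** The iteration u -> (h - offdiag u) / a keeps the bound B on the power sums and converges
    pointwise at a geometric rate; the limit is the solution. *)
Lemma cell_surj_large a : 2 ^+ 8 <= normc a -> cell_surj a.
Proof.
have [T TE] : exists T : R, T = 2 ^+ 8 by eexists.
rewrite -TE => aT h [B hB]; have B0 := psum_ge0 hB.
have T8 : 8 <= T by rewrite TE !exprS expr0; lra.
have T0 : 0 < T by apply: lt_le_trans T8.
have Tn0 : T != 0 by rewrite gt_eqF.
have a0 : a != 0 by apply: contraTneq aT => ->; rewrite normc0 -ltNge.
have [H H0 hH] := psum_bounded p_gt0 hB.
pose u := fix u n : word -> C :=
  if n is m.+1 then fun x => a^-1 * (h x - offdiag (u m) x) else fun=> 0.
have na : normc a^-1 <= T^-1.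
  by rewrite normcV lef_pV2 ?posrE //; apply: lt_le_trans aT.
have T18 : T^-1 <= 1 / 8 by rewrite mul1r lef_pV2 ?posrE.
have na0 := normc_ge0 a^-1.
have su n : psum p (u n) B.
  elim: n => [|n IH]; first by apply: psum_le B0 _; apply: psum0.
  have := psumZ a^-1 (psumD p_gt0 hB (psumN p_gt0 (psum_offdiag IH))).
  apply: psum_le; set c := 2 `^ p.
  have c1 : 1 <= c by rewrite -(powRr0 2) ler_powR ?ler1n // ltW.
  (* T^p = c^8 and c >= 2, so dividing by a absorbs the constant c (1 + 10 c^3) <= 11 c^4 of one
     iteration. *)
  have ap : normc a^-1 `^ p <= (11 * c ^+ 4)^-1.
    apply: le_trans (powR_mono p_gt0 na0 na) _.
    have X0 : 0 < 11 * c ^+ 4 by rewrite mulr_gt0 ?exprn_gt0 //; lra.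
    have XT : 11 * c ^+ 4 <= T `^ p.
      rewrite TE (_ : 2 ^+ 8 = 2 * (2 * (2 * (2 * (2 * (2 * (2 * 2))))))); last by ring.
      rewrite !powRM ?mulr_ge0 // -/c.
      have c2 : 2 <= c by rewrite -[leLHS]powRr1 // ler_powR ?ler1n // ltW.
      rewrite (_ : c * _ = c ^+ 4 * c ^+ 4); last by ring.
      rewrite ler_wpM2r ?exprn_ge0 //; first lra.
      apply: le_trans (_ : 2 ^+ 4 <= _); first by rewrite !exprS expr0; lra.
      by rewrite lerXn2r ?nnegrE //; lra.
    rewrite -[leRHS]mul1r ler_pdivlMr //.
    apply: le_trans (_ : (T^-1) `^ p * T `^ p <= _).
      by rewrite ler_wpM2l // powR_ge0.
    by rewrite -powRM ?invr_ge0 ?(ltW T0) // mulVf // powR1.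
  apply: le_trans (_ : (11 * c ^+ 4)^-1 * (c * (B + 10 * c ^+ 3 * B)) <= _).
    rewrite ler_wpM2r // mulr_ge0 ?addr_ge0 ?mulr_ge0 ?exprn_ge0 //; lra.
  rewrite mulrC ler_pdivrMr; last by rewrite mulr_gt0 ?exprn_gt0 //; lra.
  have : 0 <= (c ^+ 3 - 1) * c * B.
    by rewrite !mulr_ge0 ?subr_ge0 ?exprn_ege1 //; lra.
  rewrite !exprS expr0 mulr1; nra.
have du n : forall x, normc (u n.+1 x - u n x) <= H / 2 ^+ n.
  elim: n => [|n IH] x.
    rewrite /= /offdiag /fsum big1 // addr0 !subr0 expr0 divr1 normcM.
    have := hH x; have := normc_ge0 (h x); nra.
  have -> : u n.+2 x - u n.+1 x =
      - (a^-1 * offdiag (fun y => u n.+1 y - u n y) x).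
    by rewrite /offdiag /fsum sumrB /= /offdiag /fsum; ring.
  rewrite normcN normcM; have := offdiag_bound IH x.
  set K := H / 2 ^+ n; have -> : H / 2 ^+ n.+1 = K / 2.
    by rewrite /K exprS; field; rewrite expf_neq0.
  have := normc_ge0 (offdiag (fun y => u n.+1 y - u n y) x); nra.
have [l hl] := choice (fun x => nested_limitC (fun n => du n x)).
exists l.
  exists (2 `^ p * (B + 1)) => s us.
  (* A finite form of Fatou's lemma: at each point of s the iterate u n is within 1 / (size s + 1)
     of the limit, which costs at most 1 in all. *)
  have [n hn] := geometric_small (mulr_ge0 (ler0n R 4) H0)
    (divr_gt0 ltr01 (ltr0Sn R (size s))).
  have := psumD p_gt0 (su n) (_ : psum p (fun x => if x \in s then l x - u n x else 0) 1).
  move=> /(_ _ s us) h'; apply: le_trans (h' _).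
    rewrite big_seq [leRHS]big_seq; apply: ler_sum => x xs.
    by rewrite xs addrC subrK.
  move=> v uv; apply: (@le_trans _ _ (\sum_(x <- v) (if x \in s then (size s).+1%:R^-1 else 0))).
    apply: ler_sum => x _; case: ifP => _; last by rewrite normc0 powR0 ?gt_eqF.
    have e1 : normc (l x - u n x) <= (size s).+1%:R^-1.
      rewrite -normcN opprB; apply: le_trans (hl x n) _.
      by apply: le_trans hn _; rewrite mul1r.
    apply: le_trans (e1); rewrite -mulr_powRB1 ?normc_ge0 //.
    rewrite ler_piMr ?normc_ge0 //.
    apply: le_trans (_ : 1 `^ (p - 1) <= _); last by rewrite powR1.
    apply: powR_mono; rewrite ?subr_gt0 ?normc_ge0 //.
    by apply: le_trans e1 _; rewrite invf_le1 ?ler1n.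
  rewrite -big_mkcond /= -big_filter big_const_seq count_predT iter_addr_0.
  rewrite -[leLHS]mulr_natr ler_pdivrMl // mulr1 ler_nat leqW //.
  by apply: uniq_leq_size; [apply: filter_uniq|move=> x; rewrite mem_filter => /andP[]].
move=> x; apply/eqP; rewrite -subr_eq0; apply/eqP/eq0_normc/eqP.
rewrite eq_le normc_ge0 andbT leNgt; apply/negP => d0.
set d := normc _ in d0.
have na4 : 0 < 2 * (normc a + 4) by have := normc_ge0 a; lra.
have [n hn] := geometric_small (mulr_ge0 (ler0n R 4) H0) (divr_gt0 d0 na4).
(* The residual of the limit is expressed by the errors of two consecutive iterates, which tend to
   0. *)
have e : cellop a l x - h x =
    a * (l x - u n.+1 x) + offdiag (fun y => l y - u n y) x.
  have -> : cellop a l x = a * l x + offdiag l x by rewrite /cellop /offdiag addrA.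
  have -> : offdiag (fun y => l y - u n y) x = offdiag l x - offdiag (u n) x.
    by rewrite /offdiag /fsum sumrB; ring.
  by rewrite [u n.+1 x]/=; field.
have hl' y m : normc (l y - u m y) <= 4 * H / 2 ^+ m.
  by rewrite -normcN opprB.
have : d <= normc a * (4 * H / 2 ^+ n) + 4 * (4 * H / 2 ^+ n).
  rewrite /d e; apply: le_trans (le_normcD _ _) _; apply: lerD.
    rewrite normcM ler_wpM2l ?normc_ge0 //; apply: le_trans (hl' x n.+1) _.
    rewrite ler_wpM2l ?mulr_ge0 // lef_pV2 ?posrE ?exprn_gt0 //.
    by rewrite exprS ler_peMl ?exprn_ge0 // ler1n.
  by apply: offdiag_bound => y; apply: hl'.
rewrite -mulrDl => h1.
have : (normc a + 4) * (4 * H / 2 ^+ n) <= (normc a + 4) * (d / (2 * (normc a + 4))).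
  by rewrite ler_wpM2l //; lra.
have -> : (normc a + 4) * (d / (2 * (normc a + 4))) = d / 2.
  by field; rewrite gt_eqF //; lra.
lra.
Qed.

Lemma cell_bijective (z : C) : ~ julia R z ->
  (forall k, iter k (@decimation R) z != 3) ->
  (forall k, iter k (@decimation R) z != 5) ->
  cell_inj (z - 4) /\ cell_surj (z - 4).
Proof.
move=> Jz z3 z5.
(* Where the orbit has modulus at least 2^8 + 4, a = lambda - 4 has modulus at least 2^8;
   bijectivity then descends from level k to level 0. *)
have [k hk] : exists k, 2 ^+ 8 + 4 <= normc (iter k (@decimation R) z).
  apply: contrapT => ne; apply: Jz; exists (2 ^+ 8 + 4) => k.
  case: (leP (normc (iter k (@decimation R) z)) (2 ^+ 8 + 4)) => // /ltW h.
  by exfalso; apply: ne; exists k.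
have base : cell_inj (iter k dec (z - 4)) /\ cell_surj (iter k dec (z - 4)).
  rewrite iter_dec.
  have h4 : normc (4 : C) = 4 by have := normcMn (1 : C) 4; rewrite normc1.
  have h : 2 ^+ 8 <= normc (iter k (@decimation R) z - 4).
    have := le_normcD (iter k (@decimation R) z - 4) 4; rewrite subrK h4.
    by move: hk; set T := 2 ^+ 8; lra.
  split; last exact: cell_surj_large.
  by apply: cell_inj_large; apply: le_trans _ h; rewrite !exprS expr0; lra.
move: base; clear hk; elim: k => [//|k IH] /= [h1 h2]; apply: IH.
have a1 : iter k dec (z - 4) ^+ 2 != 1.
  rewrite iter_dec sqrf_eq1 negb_or; apply/andP; split; apply/eqP => e.
    by move/eqP: (z5 k); apply; rewrite -(subrK 4 (iter k _ z)) e; ring.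
  by move/eqP: (z3 k); apply; rewrite -(subrK 4 (iter k _ z)) e; ring.
by split; [apply: cell_inj_step|apply: cell_surj_step].
Qed.

End Resolvent.

(** * Localized eigenfunctions *)

Section Localized.
Variable R : realType.
Local Notation C := (R[i]).

(** K lists cells to avoid, so that eigenfunctions with disjoint supports can be chosen in turn; x0
    fixes the component carrying the support. *)
Definition localized a (x0 : word) (K : seq word) (g : word -> C) : Prop :=
  [/\ exists s : seq word, forall y, y \notin s -> g y = 0,
      forall y, y \in K -> g y = 0,
      forall y, g y != 0 -> tail_eq y x0,
      exists y, g y != 0 &
      forall y, cellop a g y = 0].

Lemma fresh_word (x : word) (K : seq word) : exists2 z, tail_eq z x & z \notin K.
Proof.
apply: contrapT => ne.
pose v m : word := fun n => if n == m then x n + 1 else x n.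
have vI : injective v.
  move=> m n e; have := congr1 (fun f => f m) e; rewrite /v eqxx.
  case: eqP => // _ /eqP; rewrite -subr_eq0 addrC addKr.
  by [].
have vK m : v m \in K.
  apply: contrapT => /negP h; apply: ne; exists (v m) => //.
  by exists m.+1 => n mn; rewrite /v gtn_eqF.
have : uniq [seq v m | m <- iota 0 (size K).+1] by rewrite map_inj_uniq // iota_uniq.
move=> /uniq_leq_size h; have : (size [seq v m | m <- iota 0 (size K).+1] <= size K)%N.
  by apply: h => y /mapP[m _ ->].
by rewrite size_map size_iota ltnn.
Qed.

Definition pre (K : seq word) : seq word :=
  [seq scons c y | c <- enum 'I_3, y <- K].

Lemma mem_pre K y : tl y \in K -> y \in pre K.
Proof.
move=> h; rewrite -(scons_tl y).
by apply: allpairs_f => //; rewrite mem_enum.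
Qed.

Lemma flip_scons_same (i : 'I_3) z :
  exists k z', flip (scons i (scons i z)) = scons k (scons k z').
Proof.
rewrite -nb_scons_eq /nb twin_scons_eq /= twin_scons_eq /=.
by exists (twin z i).2, (twin z i).1.
Qed.

Lemma word_split (x : word) : exists i y, x = scons i y.
Proof. by exists (x 0), (tl x); rewrite scons_tl. Qed.

Lemma letters3 (j : 'I_3) : [/\ j != j + 1, j - 1 != j & j - 1 != j + 1].
Proof.
split; rewrite -subr_eq0; move: j; do 2?[case=> -[|[|[|?]]] ?] => //.
Qed.

Lemma letterP (j i : 'I_3) : [\/ i = j, i = j + 1 | i = j - 1].
Proof.
have [h1 h2 h3] := letters3 j; have [c [c1 c2 h]] := third_letter h1.
have := h (j - 1); rewrite (negbTE h2) (negbTE h3) /= => /eqP ->.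
have /or3P[/eqP|/eqP|/eqP] := h i; by [constructor 1|constructor 2|constructor 3].
Qed.

(** The six cells with different first letters i, j in a level 2 block surround its central hole.
    Alternating signs around this hexagon make the triple sums vanish and g odd under [flip] on its
    support, as a = 1 requires. *)
Lemma localized5 x0 K : exists g, localized 1 x0 K g.
Proof.
have [z zx zK] := fresh_word (tl (tl x0)) [seq tl (tl y) | y <- K].
pose c (i j : 'I_3) : C := if i == j then 0 else if i == j + 1 then 1 else -1.
pose g (y : word) : C := if tl (tl y) == z then c (y 0) (y 1%N) else 0.
have gE i j r : g (scons i (scons j r)) = if r == z then c i j else 0 by [].
exists g; split.
- exists (pre (pre [:: z])) => y yK; rewrite /g; case: eqP => // e.
  by move: yK; rewrite mem_pre // mem_pre // e mem_head.
- move=> y yK; rewrite /g; case: eqP => // e.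
  by move: zK; rewrite -e (map_f (fun y => tl (tl y))).
- move=> y; rewrite /g; case: (tl (tl y) =P z) => [e _|_ /eqP //].
  by apply: (@tail_eq_iterI 2); rewrite /= e.
- exists (scons (0 + 1) (scons 0 z)).
  have [h1 _ _] := letters3 0.
  by rewrite gE eqxx /c [0 + 1 == 0]eq_sym (negbTE h1) eqxx oner_neq0.
- move=> y; rewrite /cellop.
  have -> : fsum g (tl y) = 0.
    have [j [r ->]] := word_split (tl y).
    have [h1 h2 h3] := letters3 j.
    rewrite /fsum (sum_letters _ h1 h2 h3) !gE; case: eqP => _; last by ring.
    rewrite /c eqxx (eq_sym (j + 1)) (negbTE h1) eqxx (negbTE h2) (negbTE h3).
    by ring.
  rewrite addr0 mul1r.
  have [i [y' ->]] := word_split y; have [j [r ->]] := word_split y'.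
  (* Cells with i = j lie at the corners of the block and flip to cells with two equal first
     letters, where g vanishes too. *)
  have [<-|ij] := eqVneq i j.
    have [k [r' ->]] := flip_scons_same i r.
    by rewrite !gE /c !eqxx; do 2?case: ifP; rewrite addr0.
  rewrite flip_scons2 // !gE; case: eqP => _; last by rewrite addr0.
  rewrite /c (eq_sym j) (negbTE ij).
  have [h1 h2 h3] := letters3 j.
  case: (letterP j i) ij => ->; rewrite ?eqxx // => ij.
    have -> : (j == j + 1 + 1) = false.
      by apply/negbTE; case: (j) => -[|[|[|?]]] ?.
    by rewrite subrr.
  by rewrite subrK eqxx (negbTE h3) addNr.
Qed.

(** The twelve cells around the central hole of a level 3 block come in two per triple. Their values
    are opposite within a triple and equal across [flip], as a = -1 requires. *)
Lemma localized3 x0 K : exists g, localized (-1) x0 K g.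
Proof.
have [z zx zK] := fresh_word (tl (tl (tl x0))) [seq tl (tl (tl y)) | y <- K].
pose c (i j k : 'I_3) : C :=
  if (i == k) || (j == k) then 0 else if i == j then 1 else -1.
pose g (y : word) : C :=
  if tl (tl (tl y)) == z then c (y 0) (y 1%N) (y 2%N) else 0.
have gE i j k r : g (scons i (scons j (scons k r))) = if r == z then c i j k else 0.
  by [].
exists g; split.
- exists (pre (pre (pre [:: z]))) => y yK; rewrite /g; case: eqP => // e.
  by move: yK; rewrite !mem_pre // e mem_head.
- move=> y yK; rewrite /g; case: eqP => // e.
  by move: zK; rewrite -e (map_f (fun y => tl (tl (tl y)))).
- move=> y; rewrite /g; case: (tl (tl (tl y)) =P z) => [e _|_ /eqP //].
  by apply: (@tail_eq_iterI 3); rewrite /= e.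
- exists (scons 0 (scons 0 (scons (0 + 1) z))).
  have [h1 _ _] := letters3 0.
  by rewrite gE eqxx /c (negbTE h1) eqxx /= oner_neq0.
- move=> y; rewrite /cellop.
  have -> : fsum g (tl y) = 0.
    have [j [y' ->]] := word_split (tl y); have [k [r ->]] := word_split y'.
    rewrite /fsum; under eq_bigr do rewrite gE.
    case: eqP => _; last by rewrite big1.
    rewrite /c; have [->|jk] := eqVneq j k.
      by rewrite big1 // => i _; rewrite orbT.
    have [m [mj mk _]] := third_letter jk.
    rewrite (sum_letters _ jk mj mk) ?eqxx ?(negbTE jk) ?(negbTE mj) ?(negbTE mk) /=.
    by ring.
  rewrite addr0 mulN1r addrC; apply/eqP; rewrite subr_eq0; apply/eqP.
  have [i [y1 ->]] := word_split y; have [j [y2 ->]] := word_split y1.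
  have [k [r ->]] := word_split y2.
  have [<-|ij] := eqVneq i j.
    have [<-|ik] := eqVneq i k.
      rewrite -nb_scons_eq /nb !twin_scons_eq /= !gE /c !eqxx.
      by do 2?case: ifP.
    rewrite -nb_scons_eq /nb !twin_scons_eq twin_scons_neq 1?eq_sym //= !gE.
    rewrite /c; by rewrite [k == i]eq_sym !eqxx (negbTE ik).
  by rewrite flip_scons2 // !gE /c (eq_sym j i) orbC.
Qed.

(** A coarse eigenfunction G is pulled back to g = (a - P)(G o tl), so that (a + P) g = (a^2 - 1) G
    o tl. By the equation for G, the triple sums of g cancel this. *)
Lemma localized_step a : a ^+ 2 != 1 ->
  (forall x0 K, exists g, localized (dec a) x0 K g) ->
  forall x0 K, exists g, localized a x0 K g.
Proof.
move=> a1 IH x0 K.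
have [G [[s hs] GK GT [y0 Gy] AG]] :=
  IH (tl x0) ([seq tl y | y <- K] ++ [seq tl (flip y) | y <- K]).
pose g y := a * G (tl y) - G (tl (flip y)).
have gE y : a * g y + g (flip y) = (a ^+ 2 - 1) * G (tl y).
  by rewrite /g flipK; ring.
exists g; split.
- exists (pre s ++ [seq flip y | y <- pre s]) => y.
  rewrite mem_cat negb_or => /andP[ys fs]; rewrite /g !hs ?mulr0 ?subrr //.
    by apply: contra fs => /mem_pre h; rewrite -(flipK y) map_f.
  by apply: contra ys => /mem_pre.
- move=> y yK; rewrite /g !GK ?mulr0 ?subrr //; rewrite mem_cat.
    by rewrite (map_f (fun y => tl (flip y))) ?orbT.
  by rewrite map_f.
- move=> y; rewrite /g.
  have [Gt|/GT h _] := eqVneq (G (tl y)) 0; last by apply: (@tail_eq_iterI 1).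
  have [Gf|/GT h _] := eqVneq (G (tl (flip y))) 0.
    by rewrite Gt Gf mulr0 subrr eqxx.
  apply: tail_eq_trans (_ : tail_eq (flip y) x0); last exact: (@tail_eq_iterI 1).
  by apply: tail_eq_sym; apply: tail_eq_flip.
- apply: contrapT => g0.
  have g0' y : g y = 0.
    by apply/eqP; apply: contrapT => /negP gy; apply: g0; exists y.
  have := gE (scons 0 y0); rewrite !g0' mulr0 addr0 tl_scons.
  move/esym/eqP; rewrite mulf_eq0 subr_eq0 (negbTE a1) /=.
  by rewrite (negbTE Gy).
- move=> y; rewrite /cellop gE /fsum.
  have -> : \sum_c g (scons c (tl y)) = 3 * a * G (tl y) - \sum_c G (nb (tl y) c).
    rewrite /g; under eq_bigr do rewrite tl_flip_scons tl_scons.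
    by rewrite sumrB sumr_const card_ord -mulr_natr; congr (_ - _); ring.
  have := AG (tl y); rewrite cellop_nb => /eqP; rewrite addrC addr_eq0 => /eqP ->.
  by rewrite /dec; ring.
Qed.

Lemma decimation_4 (z : C) : dec (z - 4) = decimation z - 4.
Proof. exact: (iter_dec z 1). Qed.

Lemma dec_sqr_neq1 (z : C) : z != 3 -> z != 5 -> (z - 4) ^+ 2 != 1.
Proof.
move=> z3 z5; rewrite sqrf_eq1 negb_or; apply/andP; split.
  by apply: contra z5 => /eqP e; rewrite -(subrK 4 z) e; apply/eqP; ring.
by apply: contra z3 => /eqP e; rewrite -(subrK 4 z) e; apply/eqP; ring.
Qed.

Lemma localized_exists n (z : C) : (iter n (@decimation R) z == 3) ||
  (iter n (@decimation R) z == 5) -> forall x0 K, exists g, localized (z - 4) x0 K g.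
Proof.
have base (w : C) : (w == 3) || (w == 5) ->
    forall x0 K, exists g, localized (w - 4) x0 K g.
  move=> /orP[/eqP->|/eqP->].
    by rewrite (_ : 3 - 4 = -1); [apply: localized3|ring].
  by rewrite (_ : 5 - 4 = 1); [apply: localized5|ring].
elim: n z => [|n IH] z; first exact: base.
rewrite iterSr => /IH h.
have [z35|] := boolP ((z == 3) || (z == 5)); first exact: base.
rewrite negb_or => /andP[z3 z5].
by apply: localized_step; [apply: dec_sqr_neq1|rewrite decimation_4].
Qed.

End Localized.

(** * Failure of surjectivity on the Julia set *)

Section NotSurjective.
Variables (R : realType) (p : R).
Local Notation C := (R[i]).
Hypothesis p_gt1 : 1 < p.

Let p_gt0 : 0 < p. Proof. exact: lt_trans p_gt1. Qed.

(** Preimages of 5 are taken along the branch on the same side of 5/2 as the orbit of x. Both points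
    are at distance at least 1 from 5/2, so each backward step at least halves their distance. *)
Lemma rdec_approx n (x : R) :
  (forall k, (k <= n)%N -> 0 <= iter k (@rdec R) x <= 5) ->
  exists2 y, 0 <= y <= 5 & iter n (@rdec R) y = 5 /\ `|x - y| <= 5 / 2 ^+ n.
Proof.
elim: n x => [|n IH] x hx.
  exists 5; first by lra.
  split=> //; have := hx 0%N isT; rewrite /= => /andP[h1 h2].
  by rewrite expr0 ler_norml; lra.
have [k kn|y1 /andP[y10 y15] [iy1 xy1]] := IH (rdec x).
  by rewrite -iterSr; apply: hx.
have /andP[rx0 rx5] : 0 <= rdec x <= 5 by apply: (hx 1%N).
pose s := Num.sqrt (25 / 4 - y1).
have s2 : s ^+ 2 = 25 / 4 - y1 by rewrite sqr_sqrtr //; lra.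
have s0 : 0 <= s by apply: sqrtr_ge0.
have s1 : 1 <= s by rewrite leNgt; apply/negP; nra.
have s5 : s <= 5 / 2 by rewrite leNgt; apply/negP; nra.
have x54 := rdec_separation rx5.
have bound (y : R) : 2 <= `|x + y - 5| -> rdec y = y1 -> `|x - y| <= 5 / 2 ^+ n.+1.
  move=> h2 ry.
  have e : `|x - y| * `|x + y - 5| = `|rdec x - y1|.
    by rewrite -normrM -normrN -ry /rdec; congr (`|_|); ring.
  have -> : 5 / 2 ^+ n.+1 = 5 / 2 ^+ n / 2 :> R.
    by rewrite exprS; field; rewrite expf_neq0.
  by move: xy1; rewrite -e; have := normr_ge0 (x - y); nra.
have [x52|x52] := lerP (5 / 2) x.
  have ry : rdec (5 / 2 + s) = y1.
    have -> : rdec (5 / 2 + s) = 25 / 4 - s ^+ 2 by rewrite /rdec; field.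
    by rewrite s2; ring.
  exists (5 / 2 + s); first by lra.
  rewrite iterSr ry; split=> //; apply: bound => //.
  have x1 : 1 <= x - 5 / 2 by rewrite leNgt; apply/negP; nra.
  by rewrite ger0_norm; lra.
have ry : rdec (5 / 2 - s) = y1.
  have -> : rdec (5 / 2 - s) = 25 / 4 - s ^+ 2 by rewrite /rdec; field.
  by rewrite s2; ring.
exists (5 / 2 - s); first by lra.
rewrite iterSr ry; split=> //; apply: bound => //.
have x1 : x - 5 / 2 <= -1 by rewrite leNgt; apply/negP; nra.
by rewrite ler0_norm; lra.
Qed.

Lemma julia_approx (z : C) e : julia R z -> 0 < e ->
  exists n z', iter n (@decimation R) z' = 5 /\ normc (z - z') <= e.
Proof.
move=> Jz e0; have [x -> hx] := julia_real Jz.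
have [n hn] := geometric_small (ler0n R 5) e0.
have [y _ [iy xy]] := @rdec_approx n x (fun k _ => hx k).
exists n, y%:C; rewrite decimation_real iy rmorph_nat; split=> //.
by rewrite -rmorphB normc_real; apply: le_trans hn.
Qed.

(* [t] consists of an eigenfunction, a list containing its support, and its
   eigenvalue. *)
Definition near_eigen (z : C) x0 (e : R) (K : seq word)
    (t : (word -> C) * seq word * C) : Prop :=
  let: (g, s, z') := t in
  [/\ uniq s, forall y, y \notin s -> g y = 0, forall y, y \in K -> y \notin s &
      [/\ forall y, g y != 0 -> tail_eq y x0,
          \sum_(y <- s) normc (g y) `^ p = 1,
          forall y, cellop (z' - 4) g y = 0 & normc (z - z') <= e]].

Lemma near_eigen_exists z x0 e K : julia R z -> 0 < e -> exists t, near_eigen z x0 e K t.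
Proof.
move=> Jz e0; have [n [z' [iz zz]]] := julia_approx Jz e0.
have z35 : (iter n (@decimation R) z' == 3) || (iter n (@decimation R) z' == 5).
  by rewrite iz eqxx orbT.
have [g [[s hs] gK gT [y0 gy0] Ag]] := localized_exists z35 x0 K.
pose s' := [seq y <- undup s | g y != 0].
have us' : uniq s' by rewrite filter_uniq // undup_uniq.
have mem_s' y : (y \in s') = (g y != 0).
  rewrite mem_filter mem_undup; have [//|gy /=] := eqVneq (g y) 0.
  by apply: contraTT isT => ys; rewrite hs ?eqxx in gy.
pose S := \sum_(y <- s') normc (g y) `^ p.
have S0 : 0 < S.
  rewrite /S (bigD1_seq y0) ?mem_s' //=; apply: ltr_pwDl.
    apply: powR_gt0; rewrite lt_neqAle normc_ge0 andbT eq_sym.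
    by apply: contra gy0 => /eqP/eq0_normc->.
  by apply: sumr_ge0 => y _; apply: powR_ge0.
pose c : C := (S `^ (- p^-1))%:C.
have cp : normc c `^ p = S^-1.
  rewrite normc_real ger0_norm ?powR_ge0 // -powRrM mulNr mulVf ?gt_eqF //.
  by rewrite powR_inv1 // ltW.
have c0 : c != 0.
  by rewrite -(rmorph0 (@real_complex R)) (inj_eq (@complexI R)) gt_eqF ?powR_gt0.
exists (fun y => c * g y, s', z'); split=> //.
- by move=> y; rewrite mem_s' negbK => /eqP ->; rewrite mulr0.
- by move=> y /gK gy; rewrite mem_s' gy eqxx.
split=> //.
- by move=> y; rewrite mulf_eq0 (negbTE c0); apply: gT.
- under eq_bigr do rewrite normcM powRM ?normc_ge0 // cp.
  by rewrite -mulr_sumr mulVf // gt_eqF.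
- by move=> y; rewrite cellopZ Ag mulr0.
Qed.

(** * Series of functions with disjoint finite supports *)

Section DisjointSeries.
Variables (g : nat -> word -> C) (s : nat -> seq word).
Hypotheses (us : forall n, uniq (s n))
  (gs : forall n y, y \notin s n -> g n y = 0)
  (disj : forall m n y, (m < n)%N -> y \in s m -> y \notin s n)
  (g1 : forall n, \sum_(y <- s n) normc (g n y) `^ p = 1).

Lemma disj_neq m n y : m != n -> y \in s m -> y \notin s n.
Proof.
rewrite neq_ltn => /orP[/disj|nm ym]; first by apply.
by apply: contraL ym; apply: disj.
Qed.

Lemma eventually_off y : exists M, forall n, (M <= n)%N -> g n y = 0.
Proof.
have [[m ym]|ne] := pselect (exists m, y \in s m); last first.
  by exists 0%N => n _; apply: gs; apply/negP => yn; apply: ne; exists n.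
by exists m.+1 => n mn; apply: gs; apply: disj ym.
Qed.

Definition off_bound y := sval (cid (eventually_off y)).

(** The infinite series of the c n * g n, which is locally finite; at y it may be cut off anywhere
    from [off_bound y] on. *)
Definition dsum (c : nat -> C) y := \sum_(n < off_bound y) c n * g n y.

Lemma dsumE c y N : (off_bound y <= N)%N -> dsum c y = \sum_(n < N) c n * g n y.
Proof.
move=> hN; rewrite /dsum -(subnKC hN) big_split_ord /= [X in _ + X]big1 ?addr0 //.
move=> i _; rewrite (svalP (cid (eventually_off y))) ?mulr0 //.
exact: leq_addr.
Qed.

Lemma dsum_on c y m : y \in s m -> dsum c y = c m * g m y.
Proof.
move=> ym; rewrite (@dsumE c y (maxn (off_bound y) m.+1)) ?leq_maxl //.
have mN : (m < maxn (off_bound y) m.+1)%N by rewrite leq_max ltnSn orbT.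
rewrite (bigD1 (Ordinal mN)) //= big1 ?addr0 // => i im.
rewrite (gs (disj_neq _ ym)) ?mulr0 // eq_sym.
by apply: contra im => /eqP e; apply/eqP/val_inj.
Qed.

Lemma dsum_off c y : (forall m, y \notin s m) -> dsum c y = 0.
Proof. by move=> h; rewrite /dsum big1 // => i _; rewrite gs ?mulr0. Qed.

Lemma unit_psum n : psum p (g n) 1.
Proof.
move=> v uv; rewrite -(g1 n) (bigID (mem (s n))) /= [X in _ + X]big1 ?addr0.
  rewrite -big_filter; apply: ler_sum_subseq; rewrite ?filter_uniq //.
    by move=> x; apply: powR_ge0.
  by move=> x; rewrite mem_filter => /andP[].
by move=> x xs; rewrite gs // normc0 powR0 // gt_eqF.
Qed.

Lemma dsum_powR (c : nat -> C) y N : (off_bound y <= N)%N ->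
  normc (dsum c y) `^ p = \sum_(n < N) normc (c n) `^ p * normc (g n y) `^ p.
Proof.
move=> hN; have [[m ym]|ne] := pselect (exists m, y \in s m); last first.
  rewrite dsum_off ?normc0 ?powR0 ?gt_eqF // => [|m]; last first.
    by apply/negP => ym; apply: ne; exists m.
  rewrite big1 // => i _; rewrite gs ?normc0 ?powR0 ?mulr0 ?gt_eqF //.
  by apply/negP => yi; apply: ne; exists i.
have h (i : nat) : i != m -> normc (c i) `^ p * normc (g i y) `^ p = 0.
  move=> im; rewrite (gs (disj_neq _ ym)) 1?eq_sym // normc0 powR0 ?mulr0 //.
  by rewrite gt_eqF.
have [mN|Nm] := ltnP m N.
  rewrite (dsum_on _ ym) (bigD1 (Ordinal mN)) //= big1 => [|i im].
    by rewrite addr0 normcM powRM ?normc_ge0.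
  by apply: h; apply: contra im => /eqP e; apply/eqP/val_inj.
rewrite (dsumE c hN) big1 => [|i _].
  rewrite normc0 powR0 ?gt_eqF // big1 // => i _; apply: h.
  by rewrite ltn_eqF // (leq_trans (ltn_ord i)).
rewrite (gs (disj_neq _ ym)) ?mulr0 // eq_sym.
by rewrite ltn_eqF // (leq_trans (ltn_ord i)).
Qed.

Lemma dsum_psum (c : nat -> C) B : (forall N, \sum_(n < N) normc (c n) `^ p <= B) ->
  psum p (dsum c) B.
Proof.
move=> hB v uv.
pose N := \max_(y <- v) off_bound y.
apply: le_trans (hB N); rewrite big_seq.
rewrite (eq_bigr (fun y => \sum_(n < N) normc (c n) `^ p * normc (g n y) `^ p)).
  rewrite -big_seq exchange_big; apply: ler_sum => n _; rewrite -mulr_sumr.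
  by rewrite ler_piMr ?powR_ge0 //; apply: unit_psum.
move=> y yv; apply: dsum_powR.
by rewrite /N (big_rem y) //= leq_maxl.
Qed.

Lemma dsum_psum_ge (c : nat -> C) B N : psum p (dsum c) B ->
  \sum_(n < N) normc (c n) `^ p <= B.
Proof.
move=> hB.
pose v := fix v n := if n is m.+1 then v m ++ s m else [::] : seq word.
have vs n y : y \in v n -> exists2 m, (m < n)%N & y \in s m.
  elim: n => [//|n IH] /=; rewrite mem_cat => /orP[/IH[m mn ym]|yn].
    by exists m => //; apply: ltnW.
  by exists n.
have uv n : uniq (v n).
  elim: n => [//|n IH] /=; rewrite cat_uniq IH us andbT /=.
  apply/hasPn => y yn; apply/negP => /vs[m mn ym].
  by rewrite (negbTE (disj mn ym)) in yn.
apply: le_trans (hB _ (uv N)).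
elim: N => [|N IH]; first by rewrite big_ord0 big_nil.
rewrite big_ord_recr /= big_cat /=; apply: lerD => //.
rewrite big_seq (eq_bigr (fun y => normc (c N) `^ p * normc (g N y) `^ p)).
  by rewrite -big_seq -mulr_sumr g1 mulr1.
by move=> y yN; rewrite (dsum_on _ yN) normcM powRM ?normc_ge0.
Qed.

(** The bound [off_bound x <= N] is recorded so that another series at x can be cut off at the same
    N. *)
Lemma cellop_dsum a c x :
  exists N, cellop a (dsum c) x = \sum_(n < N) c n * cellop a (g n) x /\
    (off_bound x <= N)%N.
Proof.
pose N := maxn (off_bound x) (maxn (off_bound (flip x))
  (\max_(d < 3) off_bound (scons d (tl x)))).
exists N; split; last exact: leq_maxl.
rewrite /cellop (@dsumE c x N) ?leq_maxl //.
rewrite (@dsumE c (flip x) N); last by rewrite /N maxnCA leq_maxl.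
have -> : fsum (dsum c) (tl x) = \sum_(n < N) c n * fsum (g n) (tl x).
  rewrite /fsum; under [RHS]eq_bigr do rewrite mulr_sumr.
  rewrite exchange_big; apply: eq_bigr => d _; apply: dsumE.
  rewrite /N !leq_max; apply/orP; right; apply/orP; right.
  exact: (leq_bigmax d).
rewrite mulr_sumr -!big_split /=; apply: eq_bigr => n _; ring.
Qed.

End DisjointSeries.
Lemma powR_le_inv (x y : R) : 0 <= x -> 0 <= y -> x `^ p <= y `^ p -> x <= y.
Proof.
move=> x0 y0 h; rewrite leNgt; apply/negP => lt; move: h; rewrite leNgt => /negP.
by apply; apply: gt0_ltr_powR; rewrite ?nnegrE.
Qed.

Lemma harmonic_unbounded (B : R) : exists N, B < \sum_(n < N) n.+1%:R^-1.
Proof.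
apply: contrapT => ne; apply: (@dvg_harmonic R).
apply: nondecreasing_is_cvgn.
  by apply: nondecreasing_series => n _ _; apply: harmonic_ge0.
exists B => _ [N _ <-]; rewrite /series /= big_mkord leNgt; apply/negP => h.
by apply: ne; exists N.
Qed.

Lemma cellop_shift (z z' : C) (g : word -> C) x :
  cellop (z - 4) g x = cellop (z' - 4) g x + (z - z') * g x.
Proof. by rewrite /cellop; ring. Qed.

Lemma geometric_sum_le N : \sum_(n < N) 2 ^- n.+1 <= 1 :> R.
Proof.
suff -> : \sum_(n < N) 2 ^- n.+1 = 1 - 2 ^- N :> R.
  by have := exprn_ge0 N (ler0n R 2); rewrite -invr_ge0; lra.
elim: N => [|N IH]; first by rewrite big_ord0 expr0 invr1 subrr.
by rewrite big_ord_recr /= IH exprS; field; rewrite expf_neq0.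
Qed.

(** The witness is u, the series of normalized eigenfunctions with |c n|^p = 1 / (n + 1). The
    operator multiplies its n-th term by z - zz n, which makes the image summable. *)
Lemma cell_not_surj (z : C) x0 : julia R z -> ~ Sigma5 R z -> ~ stationary x0 ->
  exists h : word -> C, [/\ summ p h, forall y, h y != 0 -> tail_eq y x0 &
    forall w, summ p w -> ~ (forall y, cellop (z - 4) w y = h y)].
Proof.
move=> Jz z5 sx0.
have e0 n : 0 < 2 ^- n.+1 :> R by rewrite invr_gt0 exprn_gt0.
have [G hG] := choice (fun nk : nat * seq word => near_eigen_exists x0 nk.2 Jz (e0 nk.1)).
pose Ks := fix Ks n := if n is m.+1 then Ks m ++ (G (m, Ks m)).1.2 else [::].
pose g n := (G (n, Ks n)).1.1; pose s n := (G (n, Ks n)).1.2.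
pose zz n := (G (n, Ks n)).2.
have H n : near_eigen z x0 (2 ^- n.+1) (Ks n) (g n, s n, zz n).
  by rewrite /g /s /zz; move: (hG (n, Ks n)); case: (G _) => [[? ?] ?].
have us n : uniq (s n) by case: (H n).
have gs n y : y \notin s n -> g n y = 0 by case: (H n) => _ h _ _; apply: h.
have sK m n y : (m < n)%N -> y \in s m -> y \in Ks n.
  elim: n => [//|n IH]; rewrite ltnS leq_eqVlt /= mem_cat => /predU1P[->|mn].
    by rewrite -/(s n) => ->; rewrite orbT.
  by move=> ym; rewrite IH.
have disj m n y : (m < n)%N -> y \in s m -> y \notin s n.
  by move=> mn ym; case: (H n) => _ _ h _; apply: h; apply: sK mn ym.
have g1 n : \sum_(y <- s n) normc (g n y) `^ p = 1 by case: (H n) => _ _ _ [].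
have gT n y : g n y != 0 -> tail_eq y x0 by case: (H n) => _ _ _ [h _ _ _]; apply: h.
have gA n y : cellop (zz n - 4) (g n) y = 0 by case: (H n) => _ _ _ [].
have gz n : normc (z - zz n) <= 2 ^- n.+1 by case: (H n) => _ _ _ [].
pose tau n : R := n.+1%:R^-1 `^ p^-1.
have tau0 n : 0 <= tau n by apply: powR_ge0.
pose c n : C := (tau n)%:C.
have cp n : normc (c n) `^ p = n.+1%:R^-1.
  rewrite normc_real ger0_norm // /tau -powRrM mulVf ?gt_eqF // powRr1 //.
pose d n : C := c n * (z - zz n).
have hsum : psum p (dsum gs disj d) 1.
  apply: dsum_psum => // N; apply: le_trans (geometric_sum_le N).
  apply: ler_sum => n _; rewrite /d normcM powRM ?normc_ge0 // cp.
  apply: le_trans (_ : normc (z - zz n) `^ p <= _).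
    by rewrite ler_piMl ?powR_ge0 // invf_le1 ?ler1n.
  apply: le_trans (gz n); rewrite -mulr_powRB1 ?normc_ge0 //.
  rewrite ler_piMr ?normc_ge0 //.
  apply: le_trans (_ : 1 `^ (p - 1) <= _); last by rewrite powR1.
  apply: powR_mono; rewrite ?subr_gt0 ?normc_ge0 //.
  by apply: le_trans (gz n) _; rewrite invf_le1 ?exprn_gt0 // exprn_ege1 // ler1n.
have on_s c' y : dsum gs disj c' y != 0 -> exists2 m, y \in s m & g m y != 0.
  move=> uy; apply: contrapT => ne.
  have [[m ym]|no] := pselect (exists m, y \in s m).
    move: uy; rewrite (dsum_on _ _ c' ym).
    have [->|gy _] := eqVneq (g m y) 0; first by rewrite mulr0 eqxx.
    by apply: ne; exists m.
  move: uy; rewrite (dsum_off _ _ c') ?eqxx // => m.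
  by apply/negP => ym; apply: no; exists m.
exists (dsum gs disj d); split; first by exists 1.
  by move=> y /on_s[m _ /gT].
move=> w [B hB] Aw.
have Au y : cellop (z - 4) (dsum gs disj c) y = dsum gs disj d y.
  have [N [-> hN]] := cellop_dsum gs disj (z - 4) c y.
  rewrite (dsumE d hN); apply: eq_bigr => n _.
  by rewrite (cellop_shift z (zz n)) gA add0r mulrA.
have f0 y : ~ stationary y -> dsum gs disj c y - w y = 0.
  move=> sy; apply: (kernel_vanish (f := fun y => dsum gs disj c y - w y) Jz z5 sy) => [e he|x]; last first.
    by rewrite cellopB Au Aw subrr.
  have e2 : 0 < e / 2 by rewrite divr_gt0.
  have [K hK] := psum_decay p_gt0 e2 hB.
  have [n hn] := nat_above ((e / 2) `^ p)^-1.
  have ep : 0 < (e / 2) `^ p by apply: powR_gt0.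
  exists (Ks n ++ K) => x; rewrite mem_cat negb_or => /andP[xn /hK hw].
  apply: le_trans (le_normcB _ _) _.
  suff : normc (dsum gs disj c x) <= e / 2 by lra.
  have [->|/on_s[m xm _]] := eqVneq (dsum gs disj c x) 0.
    by rewrite normc0 ltW.
  rewrite (dsum_on _ _ c xm) normcM.
  have nm : (n <= m)%N by rewrite leqNgt; apply: contra xn => /sK /(_ xm).
  apply: powR_le_inv; [by rewrite mulr_ge0 ?normc_ge0|exact: ltW|].
  rewrite [leLHS]powRM ?normc_ge0 // cp.
  have gm1 : normc (g m x) `^ p <= 1.
    by apply: psum_pt; apply: (unit_psum (s := s)).
  apply: le_trans (_ : m.+1%:R^-1 <= _); first by rewrite ler_piMr.
  rewrite -[leRHS]invrK lef_pV2 ?posrE ?invr_gt0 //.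
  by apply: le_trans (ltW hn) _; rewrite ler_nat leqW.
(* u agrees with w wherever it is nonzero, so it inherits the bound B, against the divergence of the
   harmonic series. *)
have uB : psum p (dsum gs disj c) B.
  apply: psum_mono hB => // y.
  have [->|/on_s[m _ /gT yx]] := eqVneq (dsum gs disj c y) 0.
    by rewrite normc0 normc_ge0.
  have /f0/eqP : ~ stationary y.
    by apply: contra_not sx0; apply: stationary_tail.
  by rewrite subr_eq0 => /eqP ->.
have [N hN] := harmonic_unbounded B.
have := dsum_psum_ge us g1 N uB; rewrite leNgt => /negP; apply.
by under eq_bigr do rewrite cp.
Qed.

End NotSurjective.

(** * The lattice in the plane *)

Section DigitSums.
Variable V : pzRingType.
Implicit Types (u : 'I_3 -> V) (l : word).

(** For u a coordinate of the q_i, this is 2^m times that coordinate of $F_{l_m}\cdots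
    F_{l_1}(q_j)$. *)
Definition dig u m l j : V := u j + \sum_(i < m) 2 ^+ i * u (l i).

Lemma dig_sumS u m l :
  \sum_(i < m.+1) 2 ^+ i * u (l i) =
  u (l 0) + (\sum_(i < m) 2 ^+ i * u (tl l i)) *+ 2.
Proof.
rewrite big_ord_recl expr0 mul1r; congr (_ + _).
rewrite -sumrMnl; apply: eq_bigr => i _.
by rewrite /bump /= exprS -mulrA mulr_natl.
Qed.

Lemma dig_eq u m l j : l 0 = j -> dig u m.+1 l j = dig u m (tl l) j *+ 2.
Proof. by move=> <-; rewrite /dig (dig_sumS u m l) addrA -mulr2n -mulrnDl. Qed.

Lemma dig_swap u m a j y : dig u m.+1 (scons j y) a = dig u m.+1 (scons a y) j.
Proof.
rewrite /dig (dig_sumS u m (scons j y)) (dig_sumS u m (scons a y)) !addrA.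
by rewrite [u a + _]addrC.
Qed.

End DigitSums.

Lemma nb_id_twin l j : nb l j = l -> twin l j = (l, j).
Proof.
rewrite /nb; have [lj|[n lt_n ln]] := twin_cases l j; first by rewrite twin_const.
rewrite (twinE lt_n ln) /= => /(congr1 (fun f => f n)).
by rewrite ltnn eqxx => e; rewrite -e eqxx in ln.
Qed.

(** If the first letter differs from j, the twin exchanges the two and the sum is symmetric in them.
    If it equals j, the sum is twice that of the tail, and induction applies. *)
Lemma dig_twin (V : pzRingType) (u : 'I_3 -> V) m l j :
  (forall n, (m <= n)%N -> nb l j n = l n) ->
  dig u m (nb l j) (twin l j).2 = dig u m l j.
Proof.
elim: m l j => [|m IH] l j h.
  have e : nb l j = l by apply/funext => n; apply: h.
  by rewrite (nb_id_twin e) e.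
have [c [y ly]] := word_split l; rewrite ly in h *.
have [cj|cj] := eqVneq c j; last first.
  by rewrite /nb twin_scons_neq //= dig_swap.
rewrite cj in h *; rewrite /nb twin_scons_eq /= !dig_eq //= !tl_scons.
by congr (_ *+ 2); apply: IH => n mn; have := h n.+1 mn; rewrite /nb twin_scons_eq.
Qed.

Lemma nb_neq l a j : a != j -> nb l a != nb l j.
Proof.
have [c [y ->]] := word_split l => aj; apply/eqP => e.
have scons_case b d : b != d -> nb (scons b y) b = nb (scons b y) d -> False.
  move=> bd; rewrite /nb twin_scons_eq (twin_scons_neq _ bd) /=.
  move=> /scons_inj[e1 e2].
  have t : twin y b = (y, d) by rewrite [LHS]surjective_pairing e1 e2.
  have /nb_id_twin : nb y b = y by rewrite /nb t.
  by rewrite t => -[db]; rewrite db eqxx in bd.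
have [ca|ca] := eqVneq c a.
  by rewrite ca in e; apply: scons_case aj e.
have [cj|cj] := eqVneq c j.
  by rewrite cj in e; apply: (scons_case j a) (esym e); rewrite eq_sym.
move: e; rewrite !nb_scons_neq // => /scons_inj[e _].
by rewrite e eqxx in aj.
Qed.

Definition ndig (c : 'I_3) m (l : word) (j : 'I_3) : nat :=
  ((j == c) + \sum_(i < m) 2 ^ i * (l i == c))%N.

Lemma ndigE (V : pzRingType) c m l j :
  (ndig c m l j)%:R = dig (fun d => (d == c)%:R) m l j :> V.
Proof.
rewrite /ndig /dig natrD natr_sum; congr (_ + _); apply: eq_bigr => i _.
by rewrite natrM natrX.
Qed.

Lemma ndigS c m l j : ndig c m.+1 l j =
  ((j == c) + (l 0 == c) + (\sum_(i < m) 2 ^ i * (tl l i == c)) * 2)%N.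
Proof.
rewrite /ndig big_ord_recl expn0 mul1n addnA; congr (_ + _)%N.
rewrite big_distrl /=; apply: eq_bigr => i _.
by rewrite /bump /= add1n expnS -mulnA mulnC.
Qed.

(* Expansions with digits among the basis vectors of $\mathbb{Z}^3$ are compared
   by the parity of the coordinates. *)
Lemma ndig_inj m l l' j j' : (forall n, (m <= n)%N -> l n = l' n) ->
  (forall c, ndig c m l j = ndig c m l' j') ->
  (l', j') = (l, j) \/ (l', j') = twin l j.
Proof.
elim: m l l' j j' => [|m IH] l l' j j' hl hd.
  left; congr (_, _); first by apply/funext => n; rewrite hl.
  have := hd j; rewrite /ndig !big_ord0 eqxx !addn0.
  by case: eqP.
have [a [y ly]] := word_split l; have [a' [y' ly']] := word_split l'.
rewrite ly ly' in hl hd *.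
have hy n : (m <= n)%N -> y n = y' n by move=> mn; apply: (hl n.+1).
pose S (y : word) c := (\sum_(i < m) 2 ^ i * (y i == c))%N.
have E c : ((j == c) + (a == c) + S y c * 2 =
    (j' == c) + (a' == c) + S y' c * 2)%N.
  by have := hd c; rewrite !ndigS.
(* Modulo 2 only the label and the first letter contribute. They are determined as an unordered
   pair, except that if they coincide both expansions are even and can be halved. *)
have P c : odd ((j == c) + (a == c)) = odd ((j' == c) + (a' == c)).
  by have := congr1 odd (E c); rewrite !oddD !oddM /= !andbF !addbF.
have fin : (forall c, S y c = S y' c) -> y' = y.
  move=> h; have := IH y y' j j hy (fun c => _).
  case=> [c|[->//]|e]; first by rewrite /ndig -!/(S _ c) h.
  by have := @twin_fix y j; rewrite -e => /(_ erefl) [].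
have [ja|ja] := eqVneq j a.
  have ja' : j' = a'.
    have := P j'; rewrite ja eqxx addnn odd_double.
    by case: (eqVneq a' j').
  subst a a'.
  have := IH y y' j j' hy (fun c => _).
  case=> [c|[-> ->]|e].
  - have := E c; rewrite /ndig -!/(S _ c); lia.
  - by left.
  - right; rewrite twin_scons_eq -e /=.
    by [].
have Pj := P j; have Pa := P a.
rewrite eqxx (eq_sym a) (negbTE ja) /= in Pj.
rewrite eqxx (negbTE ja) /= in Pa.
have [j'j|j'j] := eqVneq j' j.
  rewrite j'j in Pj Pa E *.
  have a'a : a' = a.
    by move: Pa; rewrite (negbTE ja) /=; case: eqP.
  left; rewrite a'a fin // => c; have := E c; rewrite a'a; lia.
have a'j : a' = j by move: Pj; rewrite (negbTE j'j) /=; case: eqP.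
have j'a : j' = a by move: Pa; rewrite a'j (negbTE ja) addn0; case: eqP.
right; rewrite twin_scons_neq 1?eq_sym // a'j j'a fin // => c.
by have := E c; rewrite a'j j'a; lia.
Qed.

(** * Cells and vertices as points of the plane *)

Section Points.
Variables (R : realType) (omega : word).
Local Notation C := (R[i]).
Implicit Types (l : word) (x : R * R).

Fixpoint Fs l m x : R * R := if m is k.+1 then F (l k) (Fs l k x) else x.

Lemma blowupE m (A : set (R * R)) x : blowup omega m A x <-> A (Fs omega m x).
Proof. by elim: m A => [//|m IH] A; rewrite /= IH. Qed.

Lemma cellE l m : cell (mkseq l m) = [set Fs l m (q R j) | j in setT].
Proof.
elim: m => [|m IH]; first by rewrite /cell /= /V0; apply/seteqP; split=> x [j _ <-]; exists j.
rewrite mkseqS /cell foldl_rcons -/(cell (mkseq l m)) IH.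
apply/seteqP; split=> x.
  by move=> [_ [j _ <-] <-]; exists j.
by move=> [j _ <-]; exists (Fs l m (q R j)) => //; exists j.
Qed.

Lemma V_Fs m x : V m x <-> exists l j, x = Fs l m (q R j).
Proof.
elim: m x => [|m IH] x /=.
  by split=> [[j _ <-]|[l [j ->]]]; [exists (fun=> j), j|exists j].
split=> [[i _ [y /IH[l [j ->]] <-]]|[l [j ->]]].
  exists (fun n => if n == m then i else l n), j; rewrite eqxx; congr (F _ _).
  have : forall k, (k <= m)%N ->
      Fs l k (q R j) = Fs (fun n => if n == m then i else l n) k (q R j).
    elim=> [//|k IHk] km /=; rewrite IHk ?(ltnW km) //.
    by rewrite ltn_eqF.
  exact.
by exists (l m) => //; exists (Fs l m (q R j)) => //; apply/IH; exists l, j.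
Qed.

Lemma shiftE i : Defs.shift R i = ((q R i).1 / 2, (q R i).2 / 2).
Proof.
case: i => -[|[|[|?]]] ? //; rewrite /Defs.shift /q /=.
- by congr (_, _); field.
- by rewrite mul0r.
- by rewrite mul0r.
Qed.

Lemma FsE l m x :
  Fs l m x = ((x.1 + \sum_(i < m) 2 ^+ i * (q R (l i)).1) / 2 ^+ m,
              (x.2 + \sum_(i < m) 2 ^+ i * (q R (l i)).2) / 2 ^+ m).
Proof.
elim: m => [|m IH]; first by rewrite !big_ord0 expr0 !divr1 !addr0; case: x.
rewrite /= IH /F shiftE /= !big_ord_recr /= exprS.
have p0 : 2 ^+ m != 0 :> R by rewrite expf_neq0.
by congr (_, _); field.
Qed.

(** The point $F_{\omega_1}^{-1}\cdots F_{\omega_m}^{-1}F_{l_m}\cdots F_{l_1}(q_j)$: the powers of 2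
    cancel, leaving a difference of digit sums. *)
Definition point m l j : R * R :=
  (dig (fun i => (q R i).1) m l j - \sum_(i < m) 2 ^+ i * (q R (omega i)).1,
   dig (fun i => (q R i).2) m l j - \sum_(i < m) 2 ^+ i * (q R (omega i)).2).

Lemma point_Fs m l j x : Fs omega m x = Fs l m (q R j) <-> x = point m l j.
Proof.
have p0 : (2 ^+ m)^-1 != 0 :> R by rewrite invr_eq0 expf_neq0.
rewrite !FsE /point /dig; split=> [[/(mulIf p0) <- /(mulIf p0) <-]|->].
  by rewrite !addrK; case: x.
by congr (_ / _, _ / _); rewrite /= subrK.
Qed.

Lemma point_eq m l l' j j' : (forall n, (m <= n)%N -> l n = l' n) ->
  point m l j = point m l' j' -> (l', j') = (l, j) \/ (l', j') = twin l j.
Proof.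
move=> hl; rewrite /point => -[/addIr e1 /addIr e2].
apply: (ndig_inj hl) => c.
apply/eqP; rewrite -(eqr_nat R) !ndigE; apply/eqP; move: c.
have s3 : Num.sqrt 3 != 0 :> R by rewrite gt_eqF // sqrtr_gt0.
have lin (u v w : 'I_3 -> R) (a b k : R) : (forall i, w i = a * u i + b * v i + k) ->
    dig u m l j = dig u m l' j' -> dig v m l j = dig v m l' j' ->
    dig w m l j = dig w m l' j'.
  move=> hw hu hv.
  have h y i : dig w m y i = a * dig u m y i + b * dig v m y i +
      dig (fun=> k) m y i.
    rewrite /dig !mulrDr !mulr_sumr hw.
    under eq_bigr do rewrite hw !mulrDr mulrCA (mulrCA _ b).
    by rewrite !big_split /=; ring.
  by rewrite !h hu hv.
(* On the q_i the indicators of the letters 0 and 2 are 2 y / sqrt 3 and x - y / sqrt 3, and that of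
   1 is one minus both; so equal points have equal digit counts. *)
have c0 : dig (fun d => (d == ord0)%:R) m l j =
    dig (fun d => (d == ord0)%:R) m l' j' :> R.
  apply: (lin _ _ _ 0 (2 / Num.sqrt 3) 0 _ e1 e2).
  by case=> -[|[|[|?]]] ? //; rewrite /q /=; field.
have c2 : dig (fun d => (d == ord_max)%:R) m l j =
    dig (fun d => (d == ord_max)%:R) m l' j' :> R.
  apply: (lin _ _ _ 1 (- 1 / Num.sqrt 3) 0 _ e1 e2).
  by case=> -[|[|[|?]]] ? //; rewrite /q /=; field.
move=> c.
have [->//|n0] := eqVneq c ord0; have [->//|n2] := eqVneq c ord_max.
apply: (lin _ _ _ (-1) (-1) 1 _ c0 c2) => i.
move: n0 n2; rewrite -!val_eqE /=; have := ltn_ord c; have := ltn_ord i.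
case: (nat_of_ord c) => [|[|[|?]]] //; case: (nat_of_ord i) => [|[|[|?]]] //=.
all: by move=> _ _ _ _; ring.
Qed.

Lemma point_stable m M l j : (m <= M)%N -> (forall n, (m <= n)%N -> l n = omega n) ->
  point M l j = point m l j.
Proof.
move=> mM hl; rewrite -(subnKC mM) /point /dig.
rewrite !big_split_ord /= !opprD !addrA.
have h (u : 'I_3 -> R) : \sum_(i < M - m) 2 ^+ (m + i) * u (l (m + i)%N) =
    \sum_(i < M - m) 2 ^+ (m + i) * u (omega (m + i)%N).
  by apply: eq_bigr => i _; rewrite hl ?leq_addr.
by rewrite (h (fun i => (q R i).1)) (h (fun i => (q R i).2)); congr (_, _); ring.
Qed.

Definition tail_index l (h : tail_eq l omega) : nat := sval (cid h).

Definition pos l j (h : tail_eq l omega) : R * R := point (tail_index h) l j.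

Lemma pos_point m l j (h : tail_eq l omega) :
  (forall n, (m <= n)%N -> l n = omega n) -> pos j h = point m l j.
Proof.
move=> hm; rewrite /pos -(@point_stable _ (maxn m (tail_index h))) ?leq_maxr //.
  by apply: point_stable => //; apply: leq_maxl.
exact: svalP (cid h).
Qed.

Lemma pos_max m l j (h : tail_eq l omega) : exists2 M, (m <= M)%N &
  pos j h = point M l j /\ (forall n, (M <= n)%N -> l n = omega n).
Proof.
have hn := svalP (cid h); exists (maxn m (tail_index h)); rewrite ?leq_maxl //.
have hM n : (maxn m (tail_index h) <= n)%N -> l n = omega n.
  by rewrite geq_max => /andP[_ /hn].
by split=> //; apply: pos_point.
Qed.

Lemma lattice_pos l j (h : tail_eq l omega) : lattice R omega (pos j h).
Proof.
have [M M1 [-> hM]] := pos_max 1 j h; exists M => //.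
by apply/blowupE/V_Fs; exists l, j; apply/point_Fs.
Qed.

Definition vertex l (h : tail_eq l omega) j : lattice R omega :=
  exist _ (pos j h) (mem_set (lattice_pos j h)).

Lemma point_pos m l : exists l' (h : tail_eq l' omega),
  forall j, pos j h = point m l j.
Proof.
pose l' : word := fun n => if (n < m)%N then l n else omega n.
have h : tail_eq l' omega by exists m => n mn; rewrite /l' ltnNge mn.
exists l', h => j; rewrite (@pos_point m) => [|n mn]; last by rewrite /l' ltnNge mn.
by rewrite /point /dig; congr (_ + _ - _, _ + _ - _); apply: eq_bigr => i _;
  rewrite /l' ltn_ord.
Qed.

Lemma vertex_surj (v : lattice R omega) :
  exists l (h : tail_eq l omega) j, v = vertex h j.
Proof.
have /set_mem [m _ /blowupE /V_Fs [l [j /point_Fs e]]] := valP v.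
have [l' [h hp]] := point_pos m l.
by exists l', h, j; apply: val_inj; rewrite /= e hp.
Qed.

Lemma vertex_eq l l' (h : tail_eq l omega) (h' : tail_eq l' omega) j j' :
  vertex h j = vertex h' j' <-> (l', j') = (l, j) \/ (l', j') = twin l j.
Proof.
split=> [/(congr1 val) /=|].
  have [m _ [-> hm]] := pos_max 0 j h.
  have [M mM [-> hM]] := pos_max m j' h'.
  rewrite -(point_stable j mM hm); apply: point_eq => n Mn.
  by rewrite hm ?hM // (leq_trans mM).
case=> [[e1 e2]|e]; apply: val_inj => /=.
  subst l' j'; have [m _ [-> hm]] := pos_max 0 j h.
  by rewrite (pos_point j h' hm).
have [m _ [-> hm]] := pos_max 0 j h.
have [M mM [-> hM]] := pos_max m j' h'.
rewrite -(point_stable j mM hm) /point.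
have [el ej] : l' = nb l j /\ j' = (twin l j).2 by rewrite /nb -e.
have st n : (M <= n)%N -> nb l j n = l n.
  by move=> Mn; rewrite -el hM // hm // (leq_trans mM).
by rewrite el ej !dig_twin.
Qed.

Lemma neighboursP (u v : lattice R omega) : neighbours u v <-> u <> v /\
  exists l (h : tail_eq l omega) i j, u = vertex h i /\ v = vertex h j.
Proof.
split=> -[uv].
  move=> [m [_ [t [/blowupE hu /blowupE hv]]]]; split=> //.
  pose l : word := nth ord0 t.
  have tE : tval t = mkseq l m by rewrite -[in RHS](size_tuple t) mkseq_nth.
  move: hu hv; rewrite tE cellE => -[i _ /esym/point_Fs ei] [j _ /esym/point_Fs ej].
  have [l' [h hp]] := point_pos m l.
  by exists l', h, i, j; split; apply: val_inj => /=; rewrite hp.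
move=> [l [h [i [j [eu ev]]]]]; rewrite eu ev in uv *; split=> //.
have [M M1 [hp hM]] := pos_max 1 i h; exists M; split=> //.
have sM : size (mkseq l M) == M by rewrite size_mkseq.
exists (Tuple sM); rewrite /= cellE; split; apply/blowupE.
  by exists i => //; apply/esym/point_Fs; rewrite /= hp.
by exists j => //; apply/esym/point_Fs; rewrite /= (pos_point j h hM).
Qed.

Lemma vertex_neq l (h : tail_eq l omega) i j : i != j -> vertex h i <> vertex h j.
Proof.
move=> ij /vertex_eq[[/esym/eqP]|e]; first by rewrite (negbTE ij).
have := @nb_id_twin l i; rewrite /nb -e => /(_ erefl) [ji].
by rewrite ji eqxx in ij.
Qed.

(** In the cell of a constant word the corner with that letter is its own twin; it lies in no other
    cell, and only the other two corners are its neighbours. *)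
Lemma boundary_exists : stationary omega ->
  exists u : lattice R omega, boundary_point u.
Proof.
move=> [m hm]; set a := omega m in hm.
have h : tail_eq (fun=> a) omega by exists m => n /hm.
have tw : twin (fun=> a) a = (fun=> a, a) by apply: twin_const.
have [h1 h2 h3] := letters3 a.
exists (vertex h a); rewrite /boundary_point; apply/eq_cardSP.
exists (vertex h (a + 1)).
  apply/neighboursP; split; first exact: vertex_neq.
  by exists (fun=> a), h, a, (a + 1).
suff -> : neighbours (vertex h a) `\ vertex h (a + 1) = [set vertex h (a - 1)].
  exact: card_set1.
apply/seteqP; split=> [v [/neighboursP[uv [l [h' [i [j [ea ev]]]]]] nv]|_ ->].
  have [l_a i_a] : l = (fun=> a) /\ i = a.
    by move/vertex_eq: ea; rewrite tw; case=> -[-> ->].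
  subst l i; rewrite ev in uv nv *.
  have hh k : vertex h' k = vertex h k by apply/vertex_eq; left.
  rewrite hh in uv nv *; case: (letterP a j) uv nv => -> u1 n1 //.
  by exfalso; apply: n1.
split; last exact: vertex_neq.
apply/neighboursP; split; first by apply: vertex_neq; rewrite eq_sym.
by exists (fun=> a), h, a, (a - 1).
Qed.

(** The vertex lies in exactly two cells, whose other corners are its four neighbours. Both sums
    count the vertex itself, which changes 4 into 6. *)
Lemma laplacian_vertex (f : lattice R omega -> C) l l' j j'
    (h : tail_eq l omega) (h' : tail_eq l' omega) :
  ~ stationary omega -> twin l j = (l', j') ->
  laplacian R omega f (vertex h j) =
    \sum_i f (vertex h i) + \sum_i f (vertex h' i) - 6 * f (vertex h j).
Proof.
move=> so tw.
have ll' : l <> l'.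
  move=> e; apply: so; apply: stationary_tail h _.
  have t : twin l j = (l, j) by apply: nb_id_twin; rewrite /nb tw e.
  have [lj|[n lt_n ln]] := twin_cases l j; first by exists 0%N => n _; rewrite !lj.
  by move: t; rewrite (twinE lt_n ln) => -[_ e']; rewrite e' eqxx in ln.
have same : vertex h' j' = vertex h j by apply/esym/vertex_eq; right.
have cross i i' : i != j -> vertex h i <> vertex h' i'.
  move=> ij /vertex_eq[[e _]|e]; first by apply: ll'.
  have := nb_neq l ij; rewrite /nb tw -e /=.
  by rewrite eqxx.
have [h1 h2 h3] := letters3 j; have [h1' h2' h3'] := letters3 j'.
pose r := [:: vertex h (j + 1); vertex h (j - 1); vertex h' (j' + 1); vertex h' (j' - 1)].
have ur : uniq r.
  rewrite /r /= !inE !negb_or !andbA andbT.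
  by do !(apply/andP; split); apply/eqP;
    do ?[by apply: cross; rewrite // eq_sym];
    apply: vertex_neq; rewrite // eq_sym.
have nr : neighbours (vertex h j) = [set` r].
  apply/seteqP; split=> v.
    move=> /neighboursP[uv [k [hk [i [i' [ea ev]]]]]].
    rewrite /= !inE ev; move/vertex_eq: ea => [[? ?]|e].
      subst k i; have hh d : vertex hk d = vertex h d by apply/vertex_eq; left.
      rewrite ev hh in uv *; case: (letterP j i') uv => -> // _; by rewrite eqxx ?orbT.
    rewrite tw in e; case: e => ? ?; subst k i.
    have hh d : vertex hk d = vertex h' d by apply/vertex_eq; left.
    rewrite ev hh in uv *; case: (letterP j' i') uv => -> //.
    - by rewrite same.
    - by rewrite eqxx ?orbT.
    - by rewrite eqxx ?orbT.
  rewrite /= !inE => /or4P[] /eqP -> ; apply/neighboursP; split.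
  - exact: vertex_neq.
  - by exists l, h, j, (j + 1).
  - by apply: vertex_neq; rewrite eq_sym.
  - by exists l, h, j, (j - 1).
  - by rewrite -same; apply: vertex_neq.
  - by exists l', h', j', (j' + 1); rewrite same.
  - by rewrite -same; apply: vertex_neq; rewrite eq_sym.
  - by exists l', h', j', (j' - 1); rewrite same.
rewrite /laplacian nr -fsbig_seq // /r !big_cons big_nil.
rewrite (sum_letters _ h1 h2 h3) (sum_letters _ h1' h2' h3') same.
by rewrite /=; ring.
Qed.

End Points.

(** * From the cell graph to the lattice *)

Section Transfer.
Variables (R : realType) (omega : word) (p : R).
Local Notation C := (R[i]).
Local Notation L := (lattice R omega).
Hypotheses (p_gt1 : 1 < p) (omega_ns : ~ stationary omega).

Let p_gt0 : 0 < p. Proof. exact: lt_trans p_gt1. Qed.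

Definition vrep (v : L) :
  {lj : word * 'I_3 | exists h : tail_eq lj.1 omega, v = vertex R h lj.2}.
Proof.
apply: cid; have [l [h [j e]]] := vertex_surj v.
by exists (l, j), h.
Defined.

(** The incidence operator N; the two cells at a vertex are read off from an arbitrary representing
    corner and its twin. *)
Definition spread (g : word -> C) (v : L) : C :=
  g (sval (vrep v)).1 + g (nb (sval (vrep v)).1 (sval (vrep v)).2).

(** The transpose of N, extended by zero to words that encode no cell of the lattice. *)
Definition gather (f : L -> C) (l : word) : C :=
  match pselect (tail_eq l omega) with
  | left h => \sum_j f (vertex R h j)
  | right _ => 0
  end.

Lemma gatherE f l (h : tail_eq l omega) : gather f l = \sum_j f (vertex R h j).
Proof.
rewrite /gather; case: pselect => // h'.
by apply: eq_bigr => j _; congr f; apply/vertex_eq; left.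
Qed.

Lemma gather_off f l : ~ tail_eq l omega -> gather f l = 0.
Proof. by move=> h; rewrite /gather; case: pselect. Qed.

Lemma spread_vertex g l (h : tail_eq l omega) j :
  spread g (vertex R h j) = g l + g (nb l j).
Proof.
rewrite /spread; case: (vrep _) => -[l' j'] /= [h' /vertex_eq[[-> ->] //|e]].
have := twinK l j; rewrite -e /= => e'.
by rewrite /nb e' -e /= addrC.
Qed.

Lemma laplacian_spread f v :
  laplacian R omega f v = spread (gather f) v - 6 * f v.
Proof.
have [l [h [j ->]]] := vertex_surj v.
have h' : tail_eq (nb l j) omega by apply: tail_eq_trans h; apply: tail_eq_nb.
rewrite (@laplacian_vertex _ _ f l (nb l j) j (twin l j).2 h h') //; last first.
  by rewrite /nb; case: (twin l j).
by rewrite spread_vertex !gatherE.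
Qed.

Lemma gather_spread g l z : tail_eq l omega ->
  cellop (z - 4) g l = gather (spread g) l + (z - 6) * g l.
Proof.
move=> h; rewrite (gatherE _ h); under eq_bigr do rewrite spread_vertex.
by rewrite big_split /= sumr_const card_ord cellop_nb -mulr_natr; ring.
Qed.

Lemma shifted_spread z f v : shifted (laplacian R omega) z f v =
  spread (gather f) v + (z - 6) * f v.
Proof. by rewrite /shifted laplacian_spread; ring. Qed.

Lemma spread_ext g g' : (forall l, tail_eq l omega -> g l = g' l) ->
  spread g =1 spread g'.
Proof.
move=> gg v; have [l [h [j ->]]] := vertex_surj v.
rewrite !spread_vertex !gg //; apply: tail_eq_trans h; exact: tail_eq_nb.
Qed.

Lemma gather_ext f f' : f =1 f' -> gather f =1 gather f'.
Proof. by move=> /funext ->. Qed.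

Lemma spreadD g g' c c' v : spread (fun l => c * g l + c' * g' l) v =
  c * spread g v + c' * spread g' v.
Proof. by rewrite /spread; ring. Qed.

Lemma gatherD f f' c c' l : gather (fun v => c * f v + c' * f' v) l =
  c * gather f l + c' * gather f' l.
Proof.
have [h|h] := pselect (tail_eq l omega); last by rewrite !gather_off // !mulr0 addr0.
by rewrite !(gatherE _ h) big_split /= !mulr_sumr.
Qed.

Lemma psum_partial (X Y : eqType) (k : X -> option Y) (f : Y -> C) B :
  (forall x x' y, k x = Some y -> k x' = Some y -> x = x') -> psum p f B ->
  psum p (fun x => if k x is Some y then f y else 0) B.
Proof.
move=> kI hB s us.
have -> : \sum_(x <- s) normc (if k x is Some y then f y else 0) `^ p =
    \sum_(y <- pmap k s) normc (f y) `^ p.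
  elim: s {us} => [|x s IH]; first by rewrite !big_nil.
  rewrite big_cons IH [pmap k (x :: s)]/=; case: (k x) => [y|].
    by rewrite [oapp _ _ _]/= big_cons.
  by rewrite [oapp _ _ _]/= normc0 powR0 ?gt_eqF // add0r.
apply: hB; elim: s us => [//|x s IH] /= /andP[xs us].
case kx : (k x) => [y|] /=; rewrite IH // andbT.
rewrite mem_pmap; apply/negP => /mapP[x' x's e].
by move: xs; rewrite (kI _ _ _ kx (esym e)) x's.
Qed.

Lemma summ_gather f : summ p f -> summ p (gather f).
Proof.
move=> [B hB].
pose k j l : option L :=
  match pselect (tail_eq l omega) with left h => Some (vertex R h j) | right _ => None end.
have kI j x x' y : k j x = Some y -> k j x' = Some y -> x = x'.
  rewrite /k; case: pselect => // h [<-]; case: pselect => // h'.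
  move=> /Some_inj /vertex_eq[[]//|e].
  by have := @twin_fix x' j; rewrite -e => /(_ erefl) [].
apply: (summ_ext p_gt1 _ (summ_sum p_gt1 (index_enum 'I_3)
  (fun j => ex_intro _ B (psum_partial (kI j) hB)))) => l.
rewrite /gather /k; case: pselect => [h|h] //.
by rewrite big1.
Qed.

Lemma vrep_inj : injective (fun v => sval (vrep v)).
Proof.
move=> u v; case: (vrep u) => -[l j] /= [h ->]; case: (vrep v) => -[l' j'] /= [h' ->].
by move=> [e1 e2]; apply/vertex_eq; left; rewrite e1 e2.
Qed.

Lemma psum_spread g B : psum p g B -> psum p (spread g) (2 `^ p * (B *+ 3 + B *+ 3)).
Proof.
move=> hB; apply: psumD => //.
  apply: (psum_comp (h := fun v => (sval (vrep v)).1) (k := fun v => (sval (vrep v)).2) _ hB).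
  by move=> u v [e1 e2]; apply: vrep_inj; rewrite [LHS]surjective_pairing e1 e2 -surjective_pairing.
apply: (psum_comp (h := fun v => nb (sval (vrep v)).1 (sval (vrep v)).2)
  (k := fun v => (twin (sval (vrep v)).1 (sval (vrep v)).2).2) _ hB).
move=> u v [e1 e2]; apply: vrep_inj.
have : twin (sval (vrep u)).1 (sval (vrep u)).2 = twin (sval (vrep v)).1 (sval (vrep v)).2.
  by rewrite [LHS]surjective_pairing [RHS]surjective_pairing -e2 -/(nb _ _) e1.
move=> e; have := twinK (sval (vrep u)).1 (sval (vrep u)).2.
by rewrite e twinK -!surjective_pairing.
Qed.

Lemma summ_spread g : summ p g -> summ p (spread g).
Proof. by move=> [B hB]; exists (2 `^ p * (B *+ 3 + B *+ 3)); apply: psum_spread. Qed.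

Section AwayFrom6.
Variable z : C.
Hypothesis z6 : z != 6.

Let k0 : z - 6 != 0. Proof. by rewrite subr_eq0. Qed.

(** Applying N^T to the equation puts N^T f in the kernel of [cellop (z - 4)]. It vanishes, and what
    is left of the equation is (z - 6) f = 0. *)
Lemma lattice_inj :
  (forall u, summ p u -> (forall x, cellop (z - 4) u x = 0) ->
     forall l, tail_eq l omega -> u l = 0) ->
  forall f, summ p f -> (forall v, shifted (laplacian R omega) z f v = 0) ->
  forall v, f v = 0.
Proof.
move=> inj f sf f0.
have G0 l : tail_eq l omega -> gather f l = 0.
  apply: inj (summ_gather sf) _ l => l.
  have [h|h] := pselect (tail_eq l omega); last first.
    rewrite cellop_nb gather_off // mulr0 add0r big1 // => j _.
    rewrite gather_off // => h'; apply: h; apply: tail_eq_trans h'.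
    by apply: tail_eq_sym; apply: tail_eq_nb.
  rewrite gather_spread //.
  have := gatherD (spread (gather f)) f 1 (z - 6) l; rewrite mul1r => <-.
  rewrite (@gather_ext _ (fun=> 0)) => [|v]; last by rewrite mul1r -shifted_spread.
  by rewrite (gatherE _ h) big1.
move=> v; have := f0 v; rewrite shifted_spread.
rewrite (@spread_ext _ (fun=> 0)) // /spread !add0r.
by move=> /eqP; rewrite mulf_eq0 (negbTE k0) => /eqP.
Qed.

(** For w = A^(-1) N^T h this is the resolvent (h - N A^(-1) N^T h) / (z - 6); an approximate w
    gives an approximate solution. *)
Definition lift (w : word -> C) (h : L -> C) (v : L) : C :=
  (z - 6)^-1 * h v + (- (z - 6)^-1) * spread w v.

Lemma shifted_lift w h v : shifted (laplacian R omega) z (lift w h) v - h v =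
  (- (z - 6)^-1) * spread (fun l => cellop (z - 4) w l - gather h l) v.
Proof.
rewrite shifted_spread.
rewrite (@spread_ext (gather (lift w h)) (fun l => - (z - 6)^-1 *
   (cellop (z - 4) w l - gather h l) + 1 * w l)); last first.
  by move=> l hl; rewrite gatherD (gather_spread _ _ hl); field.
by rewrite spreadD /lift; field.
Qed.

Lemma summ_lift w h : summ p w -> summ p h -> summ p (lift w h).
Proof.
by move=> sw sh; apply: summD => //; apply: summZ => //; apply: summ_spread.
Qed.

Lemma lattice_surj : cell_surj p (z - 4) -> forall h, summ p h ->
  exists2 f, summ p f & forall v, shifted (laplacian R omega) z f v = h v.
Proof.
move=> surj h sh; have [w sw hw] := surj _ (summ_gather sh).
exists (lift w h) => [|v]; first exact: summ_lift.
apply/eqP; rewrite -subr_eq0 shifted_lift.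
rewrite (@spread_ext _ (fun=> 0)) => [|l _]; last by rewrite hw subrr.
by rewrite /spread addr0 mulr0.
Qed.

Lemma lattice_dense :
  (forall g e, 0 < e -> summ p g -> (forall y, g y != 0 -> ~ stationary y) ->
    exists2 w, summ p w & psum p (fun y => cellop (z - 4) w y - g y) e) ->
  forall h e, summ p h -> 0 < e -> exists2 f, summ p f &
    psum p (fun v => shifted (laplacian R omega) z f v - h v) e.
Proof.
move=> dense h e sh e0.
pose c := normc (- (z - 6)^-1) `^ p * (2 `^ p * 6).
have c0 : 0 < c.
  rewrite !mulr_gt0 ?powR_gt0 // lt_neqAle normc_ge0 andbT eq_sym.
  by apply: contra k0 => /eqP /eq0_normc /eqP; rewrite oppr_eq0 invr_eq0.
have ns y : gather h y != 0 -> ~ stationary y.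
  move=> hy st; move: hy; rewrite gather_off ?eqxx // => h'.
  exact/omega_ns/(stationary_tail h').
have [w sw hw] := dense (gather h) (e / c) (divr_gt0 e0 c0) (summ_gather sh) ns.
exists (lift w h); first exact: summ_lift.
apply: (psum_ext p_gt0 (fun v => esym (shifted_lift w h v))).
have := psumZ (- (z - 6)^-1) (psum_spread hw).
have -> // : normc (- (z - 6)^-1) `^ p * (2 `^ p * ((e / c) *+ 3 + (e / c) *+ 3)) = e.
set X := e / c.
have -> : normc (- (z - 6)^-1) `^ p * (2 `^ p * (X *+ 3 + X *+ 3)) = c * X.
  by rewrite /c; ring.
by rewrite mulrC divfK // gt_eqF.
Qed.

(** If f solves the lattice equation for N h, then (h - N^T f) / (z - 6) solves the cell equation
    for h. *)
Lemma lattice_not_surj (h : word -> C) :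
  summ p h -> (forall y, h y != 0 -> tail_eq y omega) ->
  (forall w, summ p w -> ~ (forall y, cellop (z - 4) w y = h y)) ->
  exists2 h' : L -> C, summ p h' &
    forall f, summ p f -> ~ (forall v, shifted (laplacian R omega) z f v = h' v).
Proof.
move=> sh hT nw; exists (spread h); first exact: summ_spread.
move=> f sf hf.
pose w l := (z - 6)^-1 * h l + (- (z - 6)^-1) * gather f l.
have w_off l : ~ tail_eq l omega -> w l = 0.
  move=> hl; rewrite /w gather_off // mulr0 addr0.
  by have [->|/hT//] := eqVneq (h l) 0; rewrite mulr0.
apply: (nw w) => [|l].
  by apply: summD => //; apply: summZ => //; apply: summ_gather.
have [hl|hl] := pselect (tail_eq l omega); last first.
  rewrite cellop_nb w_off // mulr0 add0r big1 => [|j _].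
    by have [//|/hT//] := eqVneq (h l) 0.
  rewrite w_off // => h'; apply: hl; apply: tail_eq_trans h'.
  by apply: tail_eq_sym; apply: tail_eq_nb.
rewrite gather_spread //.
rewrite (@gather_ext _ (fun v => 1 * f v + 0 * f v)) => [|v].
  by rewrite gatherD /w; field.
by rewrite spreadD -hf shifted_spread; field.
Qed.

(** N g is an eigenfunction, nonzero because N^T N g = (6 - z) g on the cells of the lattice. *)
Lemma lattice_eigen (g : word -> C) x : tail_eq x omega -> g x != 0 -> summ p g ->
  (forall y, cellop (z - 4) g y = 0) ->
  exists f : L -> C, [/\ summ p f, exists v, f v != 0 &
    forall v, shifted (laplacian R omega) z f v = 0].
Proof.
move=> hx gx sg Ag; have G l : tail_eq l omega -> gather (spread g) l = - (z - 6) * g l.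
  move=> hl; have := Ag l; rewrite (gather_spread _ _ hl) => /eqP.
  by rewrite addr_eq0 mulNr => /eqP.
exists (spread g); split; first exact: summ_spread.
  apply: contrapT => ne; have : gather (spread g) x = 0.
    rewrite (gatherE _ hx) big1 // => j _; apply/eqP; apply: contrapT => /negP h.
    by apply: ne; exists (vertex R hx j).
  by rewrite G // mulNr => /eqP; rewrite oppr_eq0 mulf_eq0 (negbTE k0) (negbTE gx).
move=> v; rewrite shifted_spread (spread_ext G) /spread; ring.
Qed.

End AwayFrom6.

(* An alternating function on the hexagon of vertices in a block of level 2. *)
Lemma lattice_eigen6 : exists f : L -> C, [/\ summ p f, exists v, f v != 0 &
    forall v, shifted (laplacian R omega) 6 f v = 0].
Proof.
set zz := tl (tl omega).
pose c (i j k : 'I_3) : C :=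
  if (i == j) || (k == j) then 0 else if k == i then 1 else -1.
pose phi (lj : word * 'I_3) : C :=
  if tl (tl lj.1) == zz then c (lj.1 0) (lj.1 1%N) lj.2 else 0.
have phiE i j r k : phi (scons i (scons j r), k) = if r == zz then c i j k else 0.
  by [].
(* A corner and its twin carry the same value, so [phi] descends to vertices. *)
have on_block l k : tl (tl l) = zz -> phi (twin l k) = phi (l, k).
  have [i [l' ->]] := word_split l; have [j [r ->]] := word_split l'.
  rewrite !tl_scons => ->; have [<-|ik] := eqVneq i k; last first.
    rewrite twin_scons_neq // !phiE eqxx /c (eq_sym k i) (negbTE ik) orbC.
    by case: ifP.
  have [<-|ij] := eqVneq j i.
    by rewrite !twin_scons_eq /phi /= /c !eqxx /=; case: ifP.
  rewrite twin_scons_eq twin_scons_neq //= !phiE eqxx /c !eqxx.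
  by rewrite (eq_sym i j) (negbTE ij).
have inv l k : phi (twin l k) = phi (l, k).
  have [/eqP/on_block//|h1] := boolP (tl (tl l) == zz).
  have [/eqP h2|h2] := boolP (tl (tl (twin l k).1) == zz).
    by have := on_block _ (twin l k).2 h2; rewrite twinK -surjective_pairing.
  by rewrite /phi (negbTE h1) (negbTE h2).
pose f (v : L) := phi (sval (vrep v)).
have fE l (h : tail_eq l omega) k : f (vertex R h k) = phi (l, k).
  rewrite /f; case: (vrep _) => -[l' j'] /= [h' /vertex_eq[[-> ->] //|e]].
  by rewrite e inv.
have zT i j : tail_eq (scons i (scons j zz)) omega.
  by apply: (@tail_eq_iterI 2); apply: tail_eq_refl.
exists f; split.
- have [B hB] : exists B, psum p phi B.
    apply: (@psum_finite _ _ p_gt0 _ _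
      [seq (y, k) | y <- pre (pre [:: zz]), k <- enum 'I_3]) => -[l k] h.
    rewrite /phi /=; case: eqP => // e; move: h; rewrite allpairs_f ?mem_enum //.
    by rewrite !mem_pre // e mem_head.
  by exists B; apply: psum_comp_inj hB; apply: vrep_inj.
- exists (vertex R (zT 0 (0 + 1)) 0); rewrite fE phiE eqxx /c.
  have [h1 _ _] := letters3 0.
  by rewrite (negbTE h1) eqxx oner_neq0.
(* At 6 the equation reads N N^T f = 0, and the corner values of every cell add up to 0. *)
- move=> v; rewrite shifted_spread subrr mul0r addr0.
  rewrite (@spread_ext _ (fun=> 0)) /spread ?addr0 // => l h.
  rewrite (gatherE _ h); under eq_bigr do rewrite fE.
  have [i [l' el]] := word_split l; have [j [r el']] := word_split l'.
  rewrite el el'; under eq_bigr do rewrite phiE.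
  case: eqP => _; last by rewrite big1.
  rewrite /c; have [_|ij] := eqVneq i j; first by rewrite big1.
  have [m [mi mj _]] := third_letter ij.
  rewrite (sum_letters _ ij mi mj) !eqxx (negbTE ij) (negbTE mj) (negbTE mi) /=.
  by ring.
Qed.

End Transfer.

(** * The spectra of the Laplacian *)

Section LatticeSpectrum.
Variables (R : realType) (omega : word) (p : R).
Local Notation C := (R[i]).
Local Notation L := (lattice R omega).
Local Notation lap := (laplacian R omega).
Hypotheses (p_gt1 : 1 < p) (omega_ns : ~ stationary omega).

Let p_gt0 : 0 < p. Proof. exact: lt_trans p_gt1. Qed.

Lemma lpP (f : L -> C) : lp p f <-> summ p f.
Proof. exact: lp_psum. Qed.

Lemma shiftedB z (f g : L -> C) v :
  shifted lap z (fun u => f u - g u) v = shifted lap z f v - shifted lap z g v.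
Proof.
rewrite !shifted_spread //.
rewrite (@spread_ext _ _ (gather (fun u => f u - g u))
  (fun l => 1 * gather f l + (-1) * gather g l)) => [|l _].
  by rewrite spreadD; ring.
by rewrite -gatherD; apply: gather_ext => u; ring.
Qed.

Lemma not_point_spectrum z : ~ point_spectrum p lap z <->
  forall f, summ p f -> (forall v, shifted lap z f v = 0) -> forall v, f v = 0.
Proof.
split=> [/contrapT inj f sf f0 v|inj].
  have sh0 : shifted lap z (fun=> 0) = (fun=> 0).
    have e : (fun u => f u - f u) = (fun=> 0) by apply/funext => u; rewrite subrr.
    by apply/funext => u; have := shiftedB z f f u; rewrite e subrr.
  have -> // : f = fun=> 0.
  apply: inj; [exact/mem_set/lpP|apply/mem_set/lpP; exact: summ0|].
  by apply/funext => u; rewrite f0 sh0.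
apply; move=> f g /set_mem/lpP sf /set_mem/lpP sg fg.
apply/funext => v; apply/eqP; rewrite -subr_eq0; apply/eqP; move: v.
apply: inj; first exact: summB.
by move=> v; rewrite shiftedB fg subrr.
Qed.

(** 3 is mapped to 6 and then to -6, outside [0,5]. *)
Lemma julia_not3 (z : C) k : julia R z -> iter k (@decimation R) z != 3.
Proof.
move=> /julia_real[x -> hx]; rewrite decimation_real -(rmorph_nat (@real_complex R)).
rewrite (inj_eq (@complexI R)); apply/eqP => e.
by have := hx k.+2; rewrite !iterS e /rdec; lra.
Qed.

Lemma julia_not6 (z : C) : julia R z -> z != 6.
Proof.
move=> /julia_real[x -> hx]; rewrite -(rmorph_nat (@real_complex R)).
rewrite (inj_eq (@complexI R)); apply/eqP => e.
by have := hx 0%N; rewrite /= e; lra.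
Qed.

Lemma point_spectrumE : point_spectrum p lap = Sigma5 R `|` Sigma6 R.
Proof.
apply/seteqP; split=> z; last first.
  move=> hz; apply: contrapT => /not_point_spectrum inj.
  suff [f [sf [v /eqP fv] f0]] : exists f : L -> C,
      [/\ summ p f, exists v, f v != 0 & forall v, shifted lap z f v = 0].
    exact/fv/inj.
  have [->|z6] := eqVneq z 6; first exact: lattice_eigen6.
  have [n hn] : exists n, (iter n (@decimation R) z == 3) ||
      (iter n (@decimation R) z == 5).
    case: hz => [[n _ /= hn]|[/=/eqP|[n _ /= hn]]].
    - by exists n; rewrite hn eqxx orbT.
    - by rewrite (negbTE z6).
    - by exists n; rewrite hn eqxx.
  have [g [[s hs] _ gT [x gx] Ag]] := localized_exists hn omega [::].
  exact: (lattice_eigen p_gt1 omega_ns z6 (gT _ gx) gx (psum_finite p_gt0 hs)).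
move=> hz; apply: contrapT => ns; move: hz; apply/not_point_spectrum.
have z6 : z != 6 by apply/eqP => z6; apply: ns; right; left.
have z3 k : iter k (@decimation R) z != 3.
  by apply/eqP => e; apply: ns; right; right; exists k.
have z5 k : iter k (@decimation R) z != 5.
  by apply/eqP => e; apply: ns; left; exists k.
apply: lattice_inj => // u su u0 l hl.
have [Jz|Jz] := pselect (julia R z); last first.
  by have [inj _] := cell_bijective p_gt1 Jz z3 z5; apply: inj.
have z5' : ~ Sigma5 R z by move=> h; apply: ns; left.
apply: (kernel_vanish Jz z5') => // [st|e e0].
  exact/omega_ns/(stationary_tail hl).
by case: su => B; apply: psum_decay.
Qed.

Lemma surj_lattice (z : C) : ~ julia R z -> ~ point_spectrum p lap z ->
  set_surj (lp p) (lp p) (shifted lap z).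
Proof.
rewrite point_spectrumE => Jz ns h /lpP sh.
have z6 : z != 6 by apply/eqP => z6; apply: ns; right; left.
have [] := cell_bijective p_gt1 Jz.
- by move=> k; apply/eqP => e; apply: ns; right; right; exists k.
- by move=> k; apply/eqP => e; apply: ns; left; exists k.
move=> _ surj; have [f sf hf] := lattice_surj p_gt1 omega_ns z6 surj sh.
by exists f; [apply/lpP|apply/funext].
Qed.

Lemma not_surj_lattice (z : C) : julia R z -> ~ Sigma5 R z ->
  ~ set_surj (lp p) (lp p) (shifted lap z).
Proof.
move=> Jz z5 surj.
have [h [sh hT nw]] := cell_not_surj p_gt1 Jz z5 omega_ns.
have [h' sh' nf] := lattice_not_surj p_gt1 omega_ns (julia_not6 Jz) sh hT nw.
have [f /lpP sf hf] := surj h' (proj2 (lpP _) sh').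
by apply: (nf f sf) => v; rewrite hf.
Qed.

Lemma dense_lattice (z : C) : julia R z -> ~ Sigma5 R z ->
  lp_dense p (shifted lap z @` lp p).
Proof.
move=> Jz z5 h /lpP sh e e0.
(* Half of e^p leaves room for the strict inequality in [lp_dense]. *)
have e2 : 0 < e `^ p / 2 by rewrite divr_gt0 ?powR_gt0.
have [f sf hf] := lattice_dense p_gt1 omega_ns (julia_not6 Jz)
  (fun g d d0 sg => approx_words p_gt1 Jz z5 d0 sg) sh e2.
exists (shifted lap z f); first by exists f => //; apply/lpP.
apply: (psum_lp_norm p_gt0 e0 hf).
by have := powR_gt0 p e0; lra.
Qed.

End LatticeSpectrum.

Theorem theorem3p9 (R : realType) (omega : nat -> 'I_3)
    (no_boundary : forall x : lattice R omega, ~ boundary_point x)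
    (p : R) (p_gt1 : 1 < p) :
  point_spectrum p (laplacian R omega) = Sigma5 R `|` Sigma6 R /\
  continuous_spectrum p (laplacian R omega) = julia R `\` Sigma5 R /\
  residue_spectrum p (laplacian R omega) = set0.
Proof.
have ns : ~ stationary omega.
  by move=> /(boundary_exists R)[u]; apply: no_boundary.
have pE := point_spectrumE p_gt1 ns.
split=> //; split; apply/seteqP; split=> z //.
- move=> [np [nsurj _]]; split.
    by apply: contrapT => Jz; apply: nsurj; apply: surj_lattice.
  by move=> z5; apply: np; rewrite pE; left.
- move=> [Jz z5]; split; last first.
    by split; [apply: not_surj_lattice|apply: dense_lattice].
  rewrite pE => -[//|[/eqP|[k _ /eqP]]]; apply/negP.
    exact: julia_not6.
  exact: julia_not3.
- move=> [np [nsurj ndense]]; apply: ndense; apply: dense_lattice => //.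
    by apply: contrapT => Jz; apply: nsurj; apply: surj_lattice.
  by move=> z5; apply: np; rewrite pE; left.
Qed.
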